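(* Let $n\ge1$ and $k\ge3$ be integers and let $X=(\mathbf{P}^n)^k$. Let $$s_k=\left\lfloor\frac{(n+1)^k}{nk+1}\right\rfloor$$ and let $\delta_k\in\{0,\dots,n\}$ be the integer with $\delta_k\equiv s_k \pmod{n+1}$. Then, for every positive integer $s$: (i) If $s\le s_k-\delta_k$ then $\sigma_s(X)$ has the expected dimension. (ii) If $s\ge s_k-\delta_k+n+1$ then $\sigma_s(X)$ fills the ambient space.
   Context: Work over a field of characteristic zero (not necessarily algebraically closed). $(\mathbf{P}^n)^k=\mathbf{P}^n\times\cdots\times\mathbf{P}^n$ ($k$ factors) denotes the Segre variety embedded in $\mathbf{P}(V_1\otimes\cdots\otimes V_k)=\mathbf{P}^{(n+1)^k-1}$ with $\dim V_i=n+1$. The $s$-secant variety $\sigma_s(X)$ is the Zariski closure of the union of the linear spans of $s$-tuples of points of $X$. Its expected dimension is $\min\{(n+1)^k-1,\ snk+s-1\}$. *)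

(* Defs.v *)
From HB Require Import structures.
From mathcomp Require Import all_boot all_order all_algebra.
From mathcomp Require Import mpoly.

Set Implicit Arguments.
Unset Strict Implicit.
Unset Printing Implicit Defensive.

Import GRing.Theory.
Local Open Scope ring_scope.

(* A set of points of P^(m-1) is a predicate on 'rV[K]_m: the point [v] is
   represented by each of its nonzero coordinate vectors v, so the sets below
   contain only nonzero vectors and are stable under nonzero scaling. *)
Section ProjectiveSpace.
Variables (K : fieldType) (m : nat).
Implicit Types (A : 'rV[K]_m -> Prop) (v w : 'rV[K]_m) (f : {mpoly K[m]}).

Definition vanishes_on f A : Prop := forall w, A w -> f.@[w 0] = 0.

Definition zariski_closure A v : Prop :=
  v != 0 /\
  forall (d : nat) f, f \is d.-homog -> vanishes_on f A -> f.@[v 0] = 0.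

(* The row space of M is the linear span of its s rows. *)
Definition span_union (s : nat) A v : Prop :=
  v != 0 /\
  exists2 M : 'M[K]_(s, m), (forall i, A (row i M)) & (v <= M)%MS.

Definition secant_variety (s : nat) A : 'rV[K]_m -> Prop :=
  zariski_closure (span_union s A).

Definition fills_ambient A : Prop := forall v, v != 0 -> A v.

(* The points of Proj K[X_0, ..., X_(m-1)]: homogeneous (proper) prime ideals
   that do not contain the irrelevant ideal. *)
Definition proj_point (P : {pred {mpoly K[m]}}) : Prop :=
  [/\ idealr_closed P,
      prime_idealr_closed P,
      (forall f (d : nat), f \in P -> pihomog mdeg d f \in P)
    & exists i : 'I_m, 'X_i \notin P].

(* The homogeneous ideal of A is generated by the homogeneous polynomials that
   vanish on A. *)
Definition contains_ideal_of A (P : {pred {mpoly K[m]}}) : Prop :=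
  forall (d : nat) f, f \is d.-homog -> vanishes_on f A -> f \in P.

Definition prime_chain A (d : nat) : Prop :=
  exists P : nat -> {pred {mpoly K[m]}},
    (forall i, (i <= d)%N -> proj_point (P i) /\ contains_ideal_of A (P i)) /\
    (forall i, (i < d)%N ->
       {subset P i <= P i.+1} /\ exists2 f, f \in P i.+1 & f \notin P i).

(* Dimension of the projective K-scheme Proj (K[X] / I(A)), that is, of the
   closed subvariety of P^(m-1) defined by A.  Points of the scheme are used
   rather than chains of irreducible closed sets of K-rational points, as the
   latter give a wrong dimension in general when K is not algebraically
   closed. *)
Definition has_dimension A (d : nat) : Prop :=
  prime_chain A d /\ forall e, prime_chain A e -> (e <= d)%N.

End ProjectiveSpace.

(* Indices of the coordinates of K^(n+1) (x) ... (x) K^(n+1), k factors; there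
   are (n+1)^k of them. *)
Definition multi_index (n k : nat) : finType := {ffun 'I_k -> 'I_n.+1}.

Definition tensor (K : fieldType) (n k : nat) := 'rV[K]_#|multi_index n k|.

(* The decomposable tensor x_0 (x) ... (x) x_(k-1). *)
Definition pure_tensor (K : fieldType) (n k : nat) (x : 'I_k -> 'rV[K]_n.+1) :
    tensor K n k :=
  \row_j \prod_(i < k) x i 0 ((enum_val j : multi_index n k) i).

Definition segre (K : fieldType) (n k : nat) (t : tensor K n k) : Prop :=
  exists2 x : 'I_k -> 'rV[K]_n.+1, (forall i, x i != 0) & t = pure_tensor x.

(* The subtractions are exact for s >= 1. *)
Definition expected_dim (n k s : nat) : nat :=
  minn (n.+1 ^ k - 1) (s * n * k + s - 1).

(* Main.v *)
From Stdlib Require Import Classical FunctionalExtensionality.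
Require Import Defs.
From HB Require Import structures.
From mathcomp Require Import all_boot all_order all_algebra.
From mathcomp Require Import mpoly zify ring.

(** Write N = n + 1 and V = K^N.  The cone over the s-th secant variety is the
    closure of the image of F(x_1, ..., x_s) = sum of the decomposable tensors
    pt(x_a), so its dimension is the generic rank of dF, whose image is the sum
    of the tangent spaces at the pt(x_a).  Let t be the quotient of N^(k-1) by
    nk+1.  Since s_k - delta_k = N t, two things have to be shown: N t generic
    tangent spaces, each of dimension nk+1, are independent in the k-th tensor
    power of V, and N (t+1) of them span it.

    Induction on k ([sub_super]).  Cut the last factor V into its N coordinate
    lines and give each line t points whose last vector is the coordinate
    vector.  In the slice of index l, a point of that line contributes its
    tangent space in k-1 factors, and each of the n t other points contributes
    only itself.  Decomposable tensors span, so generic points are as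
    independent as the dimension allows ([defect_add_point]); hence t
    independent tangent spaces for k-1 factors give N t for k factors, and the
    same with t+1 for spanning.  Independence and spanning are open conditions,
    so the points may be chosen generic for all slices at once
    ([defect_split]).  A few small (n, k) need unequal labels or a remainder
    estimate.

    This step fails from two factors to three, because tangent spaces to
    rank-one matrices meet.  For k = 3 the last factor is cut into planes
    instead: up to N tangent spaces together with generic fibres fill N x N x 2
    perfectly ([pencil_defect]).  When N is odd a line or a 3-space is left
    over.  A line is easy ([matrix_defect]) but wasteful, and too wasteful for
    independence when N = 3 mod 6 and for spanning when N = 5 mod 6.  There a
    3-space is kept, and the N tangent spaces at e_i (x) e_i (x) (1, i, i^2)
    reduce the problem to one unknown scalar for each ordered pair (i, j),
    i <> j; a fibre can be made to kill the three pairs of a transitive triple,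
    and a directed triple system built on Z/m x Z/3, m odd, packs enough of
    them ([net_sub_defect], [net_super_defect]).

    From rank to dimension.  Let dF have rank D at p.  Restricting F to a flag
    of linear spaces through p on which dF_p is injective yields D homogeneous
    primes, strictly increasing because q+1 functions whose differentials are
    independent satisfy no algebraic relation ([jet_nonzero]), whereas on a
    q-dimensional space they do ([algebraic_relation]).  Conversely, elements
    picked along a chain of homogeneous primes, together with a coordinate
    outside the last one, are algebraically independent modulo the first
    ([chain_independent]), so there are at most s (nk+1) of them, the number
    of parameters of a chart.  If dF is onto, no form vanishes on the image. *)

Set Implicit Arguments.
Unset Strict Implicit.
Unset Printing Implicit Defensive.

Import GRing.Theory.

(** * Polynomials over a field of characteristic zero *)

Local Open Scope ring_scope.

Section CharZero.
Variable K : fieldType.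
Hypothesis charK0 : [pchar K] =i pred0.

Lemma natr_inj_char0 : injective (fun i : nat => i%:R : K).
Proof.
move=> i j; wlog le_ij : i j / (i <= j)%N => [hw|].
  by case/orP: (leq_total i j) => h e; [exact: hw | apply/esym/hw].
move/eqP=> e; apply/eqP; rewrite eqn_leq le_ij -subn_eq0 -(proj1 (pcharf0P K) charK0).
by rewrite natrB // subr_eq0 eq_sym.
Qed.

Lemma exists_nonroot (p : {poly K}) : p != 0 -> exists t, p.[t] != 0.
Proof.
move=> p0; pose rs : seq K := [seq i%:R | i <- iota 0 (size p)].
have urs : uniq rs by rewrite map_inj_uniq ?iota_uniq //; exact: natr_inj_char0.
have : ~~ all (root p) rs.
  apply/negP=> rrs; have := max_poly_roots p0 rrs urs.
  by rewrite size_map size_iota ltnn.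
by case/allPn=> t _ nr; exists t.
Qed.

(** Distinct digit expansions: this makes the substitution x_i = t^(E^i) injective on
    monomials of degree below E. *)
Lemma digits_inj (E : nat) n (a b : 'I_n -> nat) :
  (forall i, a i < E)%N -> (forall i, b i < E)%N ->
  (\sum_i a i * E ^ i = \sum_i b i * E ^ i)%N -> a =1 b.
Proof.
elim: n a b => [|n IH] a b ha hb; first by move=> _ [].
rewrite !big_ord_recl /= !expn0 !muln1.
have shift (c : 'I_n.+1 -> nat) :
    (\sum_(i < n) c (lift ord0 i) * E ^ bump 0 i
     = (\sum_(i < n) c (lift ord0 i) * E ^ i) * E)%N.
  by rewrite big_distrl; apply: eq_bigr => i _; rewrite /= -mulnA -expnSr.
rewrite !shift => e.
have E0 : (0 < E)%N by apply: leq_ltn_trans (ha ord0).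
have e0 : a ord0 = b ord0.
  by have := congr1 (modn^~ E) e; rewrite /= !(addnC (_ ord0)) !modnMDl !modn_small.
have e1 : (\sum_(i < n) a (lift ord0 i) * E ^ i = \sum_(i < n) b (lift ord0 i) * E ^ i)%N.
  have /eqP := e; rewrite e0 eqn_add2l => /eqP /(congr1 (divn^~ E)).
  by rewrite !mulnK.
move=> i; case: (unliftP ord0 i) => [j|] -> //.
exact: (IH (fun j => a (lift ord0 j)) (fun j => b (lift ord0 j))).
Qed.

(** Kronecker substitution turns a nonzero polynomial into a nonzero univariate one. *)
Lemma exists_nonzero_mpoly n (f : {mpoly K[n]}) :
  f != 0 -> exists v, f.@[v] != 0.
Proof.
move=> f0; pose E := msize f; pose kr (m : 'X_{1..n}) := (\sum_i m i * E ^ i)%N.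
have ltE m i : m \in msupp f -> (m i < E)%N.
  move=> hm; apply: leq_ltn_trans (msize_mdeg_lt hm).
  by rewrite mdegE (bigD1 i) //= leq_addr.
pose Q : {poly K} := \sum_(m <- msupp f) f@_m *: 'X^(kr m).
have QE t : Q.[t] = f.@[fun i => t ^+ (E ^ i)].
  rewrite mevalE horner_sum; apply: eq_bigr => m _.
  rewrite hornerZ hornerXn; congr (_ * _); rewrite -prodrXr.
  by apply: eq_bigr => i _; rewrite mulnC exprM.
suff /exists_nonroot [t ht] : Q != 0.
  by exists (fun i => t ^+ (E ^ i)); rewrite -QE.
have [m hm] : exists m, m \in msupp f.
  by case E0: (msupp f) => [|m s]; [case/eqP: f0; apply/eqP; rewrite -msupp_eq0 E0
    | exists m; rewrite mem_head].
apply/eqP => /(congr1 (fun p : {poly K} => p`_(kr m))); rewrite coef0 coef_sum.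
rewrite (bigD1_seq m) ?msupp_uniq //= coefZ coefXn eqxx mulr1 big1_seq ?addr0.
  by move/eqP; rewrite mcoeff_eq0 hm.
move=> m' /andP [ne hm']; rewrite coefZ coefXn.
case: eqP => [e|]; last by rewrite mulr0.
case/eqP: ne; apply/mnmP; apply: (@digits_inj E) => [i|i|]; rewrite ?ltE //.
Qed.

(** A set containing curves through h in every direction is Zariski dense.  Along
    the curve h + t v + O(t^2), the lowest term of g expanded at h is its lowest
    homogeneous part at v, and some v is not a zero of that form. *)
Lemma jet_nonzero q (Z : ('I_q -> K) -> Prop) (h : 'I_q -> K) :
  (forall v, exists R : 'I_q -> {poly K},
     forall t, Z (fun b => h b + t * v b + t ^+ 2 * (R b).[t])) ->
  forall g : {mpoly K[q]}, g != 0 -> exists2 z, Z z & g.@[z] != 0.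
Proof.
move=> jet g g0.
pose gh := g \mPo [tuple 'X_b + (h b)%:MP | b < q].
have ghE w : gh.@[w] = g.@[fun b => w b + h b].
  rewrite comp_mpoly_meval; apply: meval_eq => b.
  by rewrite tnth_mktuple mevalD mevalXU mevalC.
have gh0 : gh != 0.
  have [w hw] := exists_nonzero_mpoly g0.
  apply: contraNneq hw => gh0.
  rewrite (@meval_eq _ _ _ (fun b => (w b - h b) + h b)) => [|b]; last by rewrite subrK.
  by rewrite -(ghE (fun b => w b - h b)) gh0 meval0.
have exd : exists d, has (fun m => mdeg m == d) (msupp gh).
  case E0: (msupp gh) => [|m s]; first by case/eqP: gh0; apply/eqP; rewrite -msupp_eq0 E0.
  by exists (mdeg m); rewrite /= eqxx.
case: (ex_minnP exd) => d /hasP [m0 hm0 /eqP dm0] dmin.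
have d_le m : m \in msupp gh -> (d <= mdeg m)%N.
  by move=> hm; apply: dmin; apply/hasP; exists m.
have S0 : pihomog mdeg d gh != 0.
  apply/eqP => /(congr1 (mcoeff m0)); rewrite mcoeff0 pihomogE raddf_sum /= -big_filter.
  rewrite (bigD1_seq m0) ?filter_uniq ?msupp_uniq ?mem_filter ?dm0 ?eqxx //=.
  rewrite mcoeffZ mcoeffX eqxx mulr1 big1 ?addr0.
    by move/eqP; rewrite mcoeff_eq0 hm0.
  by move=> m ne; rewrite mcoeffZ mcoeffX (negPf ne) mulr0.
have [w hw] := exists_nonzero_mpoly S0.
have [R hR] := jet w.
pose P : {poly K} := \sum_(m <- msupp gh)
  gh@_m *: ('X^(mdeg m - d) * \prod_b ((w b)%:P + 'X * R b) ^+ m b).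
have P0 : P != 0.
  apply: contraNneq hw => P0; have := congr1 (fun p => p.[0]) P0.
  rewrite horner0 /P horner_sum pihomogE raddf_sum /= => e.
  apply/eqP; rewrite -[RHS]e [RHS](bigID (fun m => mdeg m == d)) /=.
  rewrite [X in _ = _ + X]big1_seq ?addr0; last first.
    move=> m /andP [ne hm]; rewrite hornerZ hornerM hornerXn expr0n subn_eq0.
    by rewrite leqNgt ltn_neqAle eq_sym ne d_le // !mul0r mulr0.
  apply: eq_bigr => m /eqP dm.
  rewrite mevalZ mevalX hornerZ hornerM hornerXn dm subnn expr0 mul1r horner_prod.
  by congr (_ * _); apply: eq_bigr => b _; rewrite horner_exp hornerD hornerM hornerX hornerC mul0r addr0.
have : 'X^d * P != 0 by rewrite mulf_neq0 ?polyX_eq0 // monic_neq0 // monicXn.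
case/exists_nonroot => t ht; exists (fun b => h b + t * w b + t ^+ 2 * (R b).[t]) => //.
apply: contraNneq ht => gz; apply/eqP.
have <- : g.@[fun b => (t * w b + t ^+ 2 * (R b).[t]) + h b] = 0.
  by apply: etrans gz; apply: meval_eq => b; rewrite addrC addrA.
rewrite -(ghE (fun b => t * w b + t ^+ 2 * (R b).[t])) mevalE hornerM hornerXn horner_sum big_distrr.
rewrite big_seq [RHS]big_seq; apply: eq_bigr => m hm /=.
rewrite hornerZ hornerM hornerXn horner_prod mulrCA; congr (_ * _).
rewrite mulrA -exprD subnKC ?d_le //.
rewrite mdegE -prodrXr -big_split /=; apply: eq_bigr => b _.
by rewrite horner_exp -exprMn hornerD hornerM hornerX hornerC mulrDr mulrA -expr2.
Qed.
End CharZero.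

(** * Algebraic relations and chains of homogeneous primes *)

(** Lists of exponents are used rather than monomials so that one variable can be
    removed by recursion. *)
Fixpoint exponents (r d : nat) : seq (seq nat) :=
  if r is r'.+1 then [seq a :: ms | a <- iota 0 d, ms <- exponents r' d]
  else [:: [::]].

Lemma size_exponents r d : size (exponents r d) = (d ^ r)%N.
Proof. by elim: r => // r IH; rewrite /= size_allpairs size_iota IH expnS. Qed.

Lemma uniq_exponents r d : uniq (exponents r d).
Proof.
elim: r => // r IH; apply: allpairs_uniq; rewrite ?iota_uniq //.
by move=> [a ms] [b ns] _ _ /= [-> ->].
Qed.

Lemma exponents_consP r d a ms :
  (a :: ms \in exponents r.+1 d) = (a < d)%N && (ms \in exponents r d).
Proof.
apply/allpairsP/andP => [[[b ns] /= [hb hns [-> ->]]]|[ha hms]].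
  by rewrite mem_iota in hb.
by exists (a, ms); rewrite mem_iota.
Qed.

Lemma nil_exponents r d : ([::] \in exponents r.+1 d) = false.
Proof. by apply/negbTE/allpairsP => -[[a ms] [_ _]]. Qed.

Section Relations.
Variable K : fieldType.

Fixpoint power_product n (fs : seq {mpoly K[n]}) (ms : seq nat) :=
  match fs, ms with
  | f :: fs', m :: ms' => f ^+ m * power_product fs' ms'
  | _, _ => 1
  end.

Definition poly_value n d (fs : seq {mpoly K[n]}) (c : seq nat -> K) :=
  \sum_(ms <- exponents (size fs) d) c ms *: power_product fs ms.

Lemma poly_value_cons n d f (fs : seq {mpoly K[n]}) c :
  poly_value d (f :: fs) c =
  \sum_(a <- iota 0 d) f ^+ a * poly_value d fs (fun ms => c (a :: ms)).
Proof.
rewrite /poly_value /= big_allpairs_dep /=; apply: eq_bigr => a _.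
by rewrite big_distrr /=; apply: eq_bigr => ms _; rewrite -scalerAr.
Qed.

Lemma poly_value_nil n d (c : seq nat -> K) : poly_value d [::] c = c [::] *: 1 :> {mpoly K[n]}.
Proof. by rewrite /poly_value big_seq1. Qed.

Lemma linear_dependence a (B : finType) (v : 'I_a -> B -> K) : (#|B| < a)%N ->
  exists2 c : 'I_a -> K, (exists i, c i != 0) & forall b, \sum_i c i * v i b = 0.
Proof.
move=> lt; pose A := \matrix_(i < a, j < #|B|) v i (enum_val j).
have : kermx A != 0.
  rewrite -mxrank_eq0 mxrank_ker subn_eq0 -ltnNge.
  exact: leq_ltn_trans (rank_leq_col _) lt.
case/rowV0Pn => c /sub_kermxP cA c0; exists (c 0).
  by apply/existsP; apply: contraNT c0 => /existsPn z; apply/eqP/rowP=> i;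
     rewrite mxE; apply/eqP; rewrite -[_ == _]negbK z.
move=> b; have := congr1 (fun M : 'rV__ => M 0 (enum_rank b)) cA; rewrite !mxE => e.
by rewrite -[RHS]e; apply: eq_bigr => i _; rewrite mxE enum_rankK.
Qed.

Lemma leq_msizeM n (p q : {mpoly K[n]}) : (msize (p * q) <= (msize p + msize q).-1)%N.
Proof.
have [->|p0] := eqVneq p 0; first by rewrite mul0r msize0.
have [->|q0] := eqVneq q 0; first by rewrite mulr0 msize0.
by rewrite msizeM.
Qed.

Lemma msize_power_product n (fs : seq {mpoly K[n]}) B d ms :
  (forall f, f \in fs -> msize f <= B.+1)%N -> ms \in exponents (size fs) d ->
  (msize (power_product fs ms) <= (size fs * (d * B)).+1)%N.
Proof.
elim: fs ms => [|f fs IH] [|m ms] hB //=; rewrite ?msize1 //.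
rewrite -/(exponents (size fs).+1 d) exponents_consP => /andP [hm hms].
apply: leq_trans (leq_msizeM _ _) _.
have h1 : (msize (f ^+ m) <= (m * B).+1)%N.
  elim: {hm} m => [|m IHm]; first by rewrite expr0 msize1.
  rewrite exprS; apply: leq_trans (leq_msizeM _ _) _.
  by have := hB f (mem_head _ _); lia.
have h2 := IH ms (fun g hg => hB g (mem_behead (s := f :: fs) hg)) hms.
have h3 : (m * B <= d * B)%N by rewrite leq_mul2r (ltnW hm) orbT.
lia.
Qed.

(** Counting: the products of powers below d are d^r in number, and lie in a space
    of dimension (C d)^q, which is smaller for large d as q < r. *)
Lemma algebraic_dependence q (fs : seq {mpoly K[q]}) : (q < size fs)%N ->
  exists d c, (exists2 ms, ms \in exponents (size fs) d & c ms != 0) /\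
              poly_value d fs c = 0.
Proof.
move=> lt; pose r := size fs.
pose B := (\max_(f <- fs) msize f)%N.
have hB f : f \in fs -> (msize f <= B.+1)%N.
  by move=> hf; apply: leqW; apply: leq_bigmax_seq.
(* b bounds the degree growth: products of powers below d have degree below d b. *)
pose b := (r * B).+1; pose d := (b ^ q).+1; pose E := (d * b)%N.
have cnt : (#|{ffun 'I_q -> 'I_E}| < d ^ r)%N.
  rewrite card_ffun !card_ord /E expnMn; apply: leq_trans (_ : d ^ q * d <= _)%N.
    by rewrite ltn_mul2l expn_gt0 /=.
  by rewrite -expnSr leq_pexp2l.
have hE : (r * (d * B) < E)%N by rewrite /E /b; lia.
pose ex i := nth [::] (exponents r d) i.
pose mn (m : {ffun 'I_q -> 'I_E}) : 'X_{1..q} := [multinom (m i : nat) | i < q].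
have [c [i0 ci0] hc] := @linear_dependence (d ^ r) _
   (fun i (m : {ffun 'I_q -> 'I_E}) => (power_product fs (ex i))@_(mn m)) cnt.
pose c' ms := if insub (index ms (exponents r d)) is Some i then c i else 0.
have c'E (i : 'I_(d ^ r)) : c' (ex i) = c i.
  rewrite /c' index_uniq ?uniq_exponents ?size_exponents //; by rewrite valK.
exists d, c'; split.
  by exists (ex i0); rewrite ?c'E // mem_nth // size_exponents.
have sumE : poly_value d fs c' = \sum_(i < d ^ r) c i *: power_product fs (ex i).
  rewrite /poly_value (big_nth [::]) size_exponents big_mkord.
  by apply: eq_bigr => i _; rewrite -c'E.
apply/mpolyP => m; rewrite mcoeff0 sumE raddf_sum /=.
case: (boolP [forall i, m i < E]%N) => [/forallP hm|/forallPn [i hi]].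
  have [m' em] : exists m' : {ffun 'I_q -> 'I_E}, mn m' = m.
    by exists [ffun i => Ordinal (hm i)]; apply/mnmP=> i; rewrite mnmE ffunE.
  by rewrite -em -[RHS](hc m'); apply: eq_bigr => i _; rewrite mcoeffZ.
apply: big1 => j _; rewrite mcoeffZ (memN_msupp_eq0 (m := m)) ?mulr0 //.
apply: msize_mdeg_ge; apply: leq_trans (msize_power_product (d := d) hB _) _.
  by rewrite /ex mem_nth // size_exponents.
apply: leq_trans hE _; rewrite -leqNgt in hi; apply: leq_trans hi _.
by rewrite mdegE (bigD1 i) //= leq_addr.
Qed.

Section Chain.
Variables (n : nat) (P : nat -> {pred {mpoly K[n]}}) (f : nat -> {mpoly K[n]}) (e : nat).
Variable x : 'I_n.
Hypothesis ptP : forall i, (i <= e)%N -> proj_point (P i).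
Hypothesis incP : forall i, (i < e)%N -> {subset P i <= P i.+1}.
Hypothesis fin : forall i, (i < e)%N -> f i \in P i.+1.
Hypothesis fout : forall i, (i < e)%N -> f i \notin P i.
Hypothesis xout : 'X_x \notin P e.

Lemma point_scale i (c : K) g : (i <= e)%N -> c != 0 -> c *: g \in P i -> g \in P i.
Proof.
move=> hi c0 h; have [[P0 _ PD] _ _ _] := ptP hi.
have -> : g = c^-1%:MP * (c *: g) + 0 by rewrite addr0 mul_mpolyC scalerA mulVf // scale1r.
exact: PD.
Qed.

Lemma point_pow i g a : (i <= e)%N -> g \notin P i -> g ^+ a \notin P i.
Proof.
move=> hi hg; have [[P0 P1 PD] Ppr _ _] := ptP hi.
elim: a => [|a IH]; rewrite ?expr0 // exprS.
by apply/negP => /Ppr; rewrite (negPf hg) (negPf IH).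
Qed.

Lemma point_sum i (I : eqType) (r : seq I) (g : I -> {mpoly K[n]}) : (i <= e)%N ->
  (forall j, j \in r -> g j \in P i) -> \sum_(j <- r) g j \in P i.
Proof.
move=> hi; have [[P0 P1 PD] Ppr _ _] := ptP hi.
elim: r => [|j r IH] h; rewrite ?big_nil // big_cons -[g j]mul1r; apply: PD.
  by apply: h; rewrite mem_head.
by apply: IH => l hl; apply: h; rewrite inE hl orbT.
Qed.

Fixpoint chain_elements (r i : nat) :=
  if r is r'.+1 then f i :: chain_elements r' i.+1 else [:: 'X_x].

Lemma size_chain_elements r i : size (chain_elements r i) = r.+1.
Proof. by elim: r i => //= r IH i; rewrite IH. Qed.

(** By induction along the chain.  In a relation lying in P i, let a be the least
    exponent of f i that occurs; f i is not in P i, so f i ^+ a can be divided out.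
    As f i lies in P i.+1, setting it to zero leaves a nontrivial relation in P i.+1
    between the later elements.  The last element is a coordinate, and there
    homogeneity isolates a single power of it. *)
Lemma chain_independent d r i c : (i + r = e)%N ->
  (exists2 ms, ms \in exponents r.+1 d & c ms != 0) ->
  poly_value d (chain_elements r i) c \notin P i.
Proof.
elim: r i c => [|r IH] i c ir [[|a0 ms] hms cms].
- by rewrite nil_exponents in hms.
- move: hms; rewrite exponents_consP inE => /andP [ha0 /eqP ems].
  rewrite {}ems in cms; have ie : i = e by lia.
  rewrite {}ie; have le := leqnn e; have [[P0 P1 PD] Ppr Ph _] := ptP le.
  rewrite poly_value_cons; apply/negP => /(Ph _ a0).
  rewrite raddf_sum /= (bigD1_seq a0) ?iota_uniq ?mem_iota //=.
  have E a : 'X_x ^+ a * poly_value d [::] (fun ms : seq nat => c (a :: ms))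
     = c [:: a] *: 'X_[(U_(x) *+ a)%MM] :> {mpoly K[n]}.
    by rewrite poly_value_nil -scalerAr mulr1 mpolyXn.
  rewrite big1 ?addr0 => [|a ne]; rewrite E linearZ /= pihomogX /= ?mdegMn ?mdeg1 ?mul1n.
    rewrite eqxx => /(point_scale le cms); rewrite -mpolyXn.
    by apply/negP; apply: point_pow.
  by rewrite (negPf ne) scaler0.
- by rewrite nil_exponents in hms.
have hi : (i <= e)%N by lia.
have [[P0 P1 PD] Ppr _ _] := ptP hi.
have exa : exists a, (a < d)%N && has (fun ms => c (a :: ms) != 0) (exponents r.+1 d).
  by move: hms; rewrite exponents_consP => /andP [h1 h2]; exists a0; rewrite h1; apply/hasP; exists ms.
case: (ex_minnP exa) => a /andP [ha /hasP [ns hns cns]] amin {exa ms cms hms a0}.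
have zero b : (b < a)%N -> poly_value d (chain_elements r i.+1) (fun ms => c (b :: ms)) = 0.
  move=> hb; rewrite /poly_value big1_seq // size_chain_elements => ms /= hms.
  case: (eqVneq (c (b :: ms)) 0) => [->|ne]; first by rewrite scale0r.
  have /amin : (b < d)%N && has (fun ms => c (b :: ms) != 0) (exponents r.+1 d).
    by rewrite (ltn_trans hb ha); apply/hasP; exists ms.
  by rewrite leqNgt hb.
rewrite /= poly_value_cons; apply/negP.
have -> : iota 0 d = iota 0 a ++ a :: iota a.+1 (d - a.+1).
  by rewrite -[RHS]/(iota 0 a ++ iota (0 + a) (d - a.+1).+1) -iotaD; congr iota; lia.
rewrite big_cat big_cons /= big1_seq ?add0r; last first.
  by move=> b /=; rewrite mem_iota => /andP [_ hb]; rewrite zero ?mulr0.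
have -> : \sum_(b <- iota a.+1 (d - a.+1)) f i ^+ b *
     poly_value d (chain_elements r i.+1) (fun ms => c (b :: ms))
   = f i ^+ a * \sum_(b <- iota a.+1 (d - a.+1)) f i ^+ (b - a) *
     poly_value d (chain_elements r i.+1) (fun ms => c (b :: ms)).
  rewrite big_distrr big_seq [RHS]big_seq; apply: eq_bigr => b /=.
  by rewrite mem_iota mulrA -exprD => hb; congr (_ ^+ _ * _); lia.
rewrite -mulrDr => /Ppr /orP []; first by apply/negP/point_pow => //; apply: fout; lia.
have hi1 : (i.+1 <= e)%N by lia.
have [[P0' P1' PD'] Ppr' _ _] := ptP hi1.
move/(incP hi1) => h.
have : poly_value d (chain_elements r i.+1) (fun ms => c (a :: ms)) \in P i.+1.
  set u := poly_value _ _ _ in h *; set v := \sum_(b <- _) _ in h.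
  have -> : u = (-1) * v + (u + v) by rewrite mulN1r addrCA addNr addr0.
  apply: (PD' _) => //; apply: point_sum => // b; rewrite mem_iota => hb.
  have -> : (b - a = (b - a).-1.+1)%N by lia.
  rewrite exprS -mulrA mulrC -[X in X \in _]addr0; apply: PD' => //.
  by apply: fin; lia.
by apply/negP; apply: IH; [lia | exists ns].
Qed.
End Chain.
End Relations.

(** * Dimension of a parametrized cone *)

Section Dimension.
Variable K : fieldType.
Hypothesis charK0 : [pchar K] =i pred0.

Lemma mpoly_eq0P n (f : {mpoly K[n]}) : (forall v, f.@[v] = 0) -> f = 0.
Proof.
move=> h; apply/eqP; apply: contraT => /(exists_nonzero_mpoly charK0) [v].
by rewrite h eqxx.
Qed.

Lemma power_product_map n m (phi : {rmorphism {mpoly K[n]} -> {mpoly K[m]}}) fs ms :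
  phi (power_product fs ms) = power_product (map phi fs) ms.
Proof.
elim: fs ms => [|f fs IH] [|a ms] /=; rewrite ?rmorph1 //.
by rewrite rmorphM rmorphXn IH.
Qed.

Lemma poly_value_comp n q d fs c (Phi : n.-tuple {mpoly K[q]}) :
  poly_value d fs c \mPo Phi = poly_value d (map (comp_mpoly Phi) fs) c.
Proof.
rewrite /poly_value size_map raddf_sum; apply: eq_bigr => ms _.
by rewrite /= comp_mpolyZ -power_product_map.
Qed.

Lemma power_productE n (fs : seq {mpoly K[n]}) ms : size ms = size fs ->
  power_product fs ms = \prod_(i < size fs) nth 0 fs i ^+ nth 0%N ms i.
Proof.
elim: fs ms => [|f fs IH] [|m ms] //=; first by rewrite big_ord0.
by move=> [/IH ->]; rewrite big_ord_recl.
Qed.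

Lemma size_of_exponents r d ms : ms \in exponents r d -> size ms = r.
Proof.
elim: r ms => [|r IH] [|m ms]; rewrite ?nil_exponents // ?inE //.
by rewrite exponents_consP => /andP [_ /IH /= ->].
Qed.

Lemma algebraic_relation q r (G : r.-tuple {mpoly K[q]}) : (q < r)%N ->
  exists2 g : {mpoly K[r]}, g != 0 & g \mPo G = 0.
Proof.
move=> lt; have ltG : (q < size G)%N by rewrite size_tuple.
have [d [c [[ms0 hms0 c0] e0]]] := algebraic_dependence ltG.
pose Xs := [tuple 'X_i : {mpoly K[r]} | i < r].
exists (poly_value d Xs c).
  apply/eqP => /(congr1 (mcoeff [multinom nth 0%N ms0 i | i < r])).
  rewrite size_tuple in hms0.
  have XE ms : ms \in exponents r d -> power_product Xs ms = 'X_[[multinom nth 0%N ms i | i < r]].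
    move=> hms; rewrite power_productE; last by rewrite size_tuple (size_of_exponents hms).
    rewrite mpolyXE_id size_tuple; apply: eq_bigr => i _.
    by rewrite mnmE -tnth_nth tnth_mktuple.
  rewrite mcoeff0 /poly_value size_tuple raddf_sum /= (bigD1_seq ms0) ?uniq_exponents //=.
  rewrite mcoeffZ XE // mcoeffX eqxx mulr1 big1_seq ?addr0.
    by move/eqP; rewrite (negPf c0).
  move=> ms /andP [ne hms]; rewrite mcoeffZ XE // mcoeffX.
  case: eqP => [e|]; last by rewrite mulr0.
  case/eqP: ne; apply: (@eq_from_nth _ 0%N); first by rewrite (size_of_exponents hms) (size_of_exponents hms0).
  rewrite (size_of_exponents hms) => i hi.
  by have /mnmP /(_ (Ordinal hi)) := e; rewrite !mnmE.
rewrite poly_value_comp; have /(congr1 val) /= -> : map_tuple (comp_mpoly G) Xs = G; last exact: e0.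
by apply: eq_from_tnth => i; rewrite tnth_map tnth_mktuple comp_mpolyXU -tnth_nth.
Qed.

Lemma dhomog_meval n d (f : {mpoly K[n]}) c v : f \is d.-homog ->
  f.@[fun i => c * v i] = c ^+ d * f.@[v].
Proof.
move/dhomogP => hf; rewrite !mevalE big_distrr big_seq [RHS]big_seq.
apply: eq_bigr => m /hf dm /=; rewrite mulrCA; congr (_ * _).
rewrite -(dm : mdeg m = d) mdegE -prodrXr -big_split; apply: eq_bigr => i _; exact: exprMn.
Qed.

(** The values of f along t^k v are a polynomial in t whose coefficients are the
    values at v of the homogeneous parts of f. *)
Lemma pihomog_vanish n k (f : {mpoly K[n]}) v d : (0 < k)%N ->
  (forall t, t != 0 -> f.@[fun i => t ^+ k * v i] = 0) ->
  (pihomog mdeg d f).@[v] = 0.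
Proof.
move=> k0 hf; pose B := (maxn (msize f) d.+1).
pose P : {poly K} := \sum_(e < B) (pihomog mdeg e f).@[v] *: 'X^(k * e).
have PE t : P.[t] = f.@[fun i => t ^+ k * v i].
  rewrite [in RHS](@pihomog_partitionE _ _ mdeg B f) ?leq_maxl // raddf_sum horner_sum.
  apply: eq_bigr => e _ /=; rewrite (dhomog_meval _ _ (pihomogP _ _ _)).
  by rewrite hornerZ hornerXn exprM mulrC.
have P0 : P = 0.
  apply/eqP; apply: contraT => nP.
  have /(exists_nonroot charK0) [t] : 'X * P != 0 by rewrite mulf_neq0 // polyX_eq0.
  rewrite hornerM hornerX PE; case: (eqVneq t 0) => [->|t0]; first by rewrite mul0r eqxx.
  by rewrite hf // mulr0 eqxx.
have hd : (d < B)%N by rewrite leq_max ltnSn orbT.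
have := congr1 (fun p : {poly K} => p`_(k * d)) P0.
rewrite coef0 coef_sum (bigD1 (Ordinal hd)) //= coefZ coefXn eqxx mulr1 big1 ?addr0 //.
move=> e ne; rewrite coefZ coefXn eqn_pmul2l // (_ : (d == e) = false) ?mulr0 //.
by apply: contraNF ne => /eqP de; apply/eqP/val_inj.
Qed.

(** The hypothesis says that the ideal of A contains the kernel of the substitution
    Phi into q variables; q+1 independent elements cannot survive that substitution. *)
Lemma prime_chain_bound n q (Phi : n.-tuple {mpoly K[q]}) (A : 'rV[K]_n -> Prop) e :
  (forall f, f \mPo Phi = 0 -> forall d, vanishes_on (pihomog mdeg d f) A) ->
  prime_chain A e -> (e < q)%N.
Proof.
move=> hA [P [ptP incP]]; rewrite ltnNge; apply/negP => le_qe.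
have pt i : (i <= e)%N -> proj_point (P i) by case/ptP.
have [_ _ _ [x hx]] := pt e (leqnn e).
have exf i : exists f, (i < e)%N ==> (f \in P i.+1) && (f \notin P i).
  case: (boolP (i < e)%N) => [/incP [_ [f h1 h2]]|_]; last by exists 0.
  by exists f; rewrite h1 h2.
pose f i := xchoose (exf i).
have fP i (hi : (i < e)%N) : (f i \in P i.+1) && (f i \notin P i).
  by have /implyP := xchooseP (exf i); apply.
pose fs := chain_elements f x e 0.
have lt : (q < size (map (comp_mpoly Phi) fs))%N by rewrite size_map size_chain_elements.
have [d [c [hc]]] := algebraic_dependence lt.
rewrite size_map size_chain_elements in hc.
rewrite -poly_value_comp => e0.
have /negP [] := chain_independent pt (fun i hi => proj1 (incP i hi))
  (fun i hi => proj1 (andP (fP i hi))) (fun i hi => proj2 (andP (fP i hi))) hx (add0n e) hc.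
rewrite [X in X \in _](@pihomog_partitionE _ _ mdeg _ _ (leqnn _)).
apply: (point_sum pt) => // i _.
have [_ cI] := ptP 0%N (leq0n e); apply: cI; first exact: pihomogP.
exact: hA.
Qed.

Lemma jet_fills n (A : 'rV[K]_n -> Prop) (Z : ('I_n -> K) -> Prop) h :
  (forall d f, f \is d.-homog -> vanishes_on f A -> forall z, Z z -> f.@[z] = 0) ->
  (forall v, exists R : 'I_n -> {poly K},
     forall t, Z (fun b => h b + t * v b + t ^+ 2 * (R b).[t])) ->
  fills_ambient (zariski_closure A).
Proof.
move=> hZ jet v v0; split=> // d f hf fA.
case: (eqVneq f 0) => [->|f0]; first by rewrite meval0.
have [z Zz] := jet_nonzero charK0 jet f0.
by rewrite (hZ d f hf fA z Zz) eqxx.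
Qed.

(** The primes are the ideals of the images under F of the spans of initial segments
    of u.  As u 0 is the base point itself, these spans are cones through it, so that the
    ideals are homogeneous and the differential is taken at u 0 on each of them. *)
Section ChainExists.
Variables (X : Type) (n k D : nat) (F : (X -> K) -> 'I_n -> K).
Variables (A : 'rV[K]_n -> Prop) (u : nat -> X -> K) (J : nat -> 'I_n -> K).
Variables (Phi : forall q, n.-tuple {mpoly K[q]}) (B : 'I_n -> nat -> K).
Hypothesis D0 : (0 < D)%N.
Hypothesis k0 : (0 < k)%N.
Hypothesis Fext : forall p p', p =1 p' -> F p =1 F p'.
Hypothesis Fhom : forall c p j, F (fun x => c * p x) j = c ^+ k * F p j.
Hypothesis PhiE : forall q (y : 'I_q -> K) j,
  (tnth (Phi q) j).@[y] = F (fun x => \sum_(l < q) y l * u l x) j.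
Hypothesis FA : forall d f, f \is d.-homog -> vanishes_on f A ->
  forall p, f.@[F p] = 0.
Hypothesis Fjet : forall q (w : 'I_q -> K), exists R : 'I_n -> {poly K}, forall t j,
  F (fun x => u 0%N x + t * \sum_(l < q) w l * u l x) j =
  F (u 0%N) j + t * \sum_(l < q) w l * J l j + t ^+ 2 * (R j).[t].
Hypothesis Jind : forall l b, (l < D)%N -> (b < D)%N ->
  \sum_j J l j * B j b = (l == b)%:R.
Variable j0 : 'I_n.
Hypothesis F0 : F (u 0%N) j0 != 0.

Let L q (y : 'I_q -> K) x := \sum_(l < q) y l * u l x.

Definition restr_ker q : {pred {mpoly K[n]}} := fun f => f \mPo Phi q == 0.

Lemma restr_kerE q f : (f \in restr_ker q) = (f \mPo Phi q == 0).
Proof. by []. Qed.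

Lemma restr_eq0P q f : (f \mPo Phi q == 0) <-> (forall y : 'I_q -> K, f.@[F (L y)] = 0).
Proof.
have E y : (f \mPo Phi q).@[y] = f.@[F (L y)].
  by rewrite comp_mpoly_meval; apply: meval_eq => j; rewrite PhiE.
split=> [/eqP e y|h]; first by rewrite -E e meval0.
by apply/eqP/mpoly_eq0P => y; rewrite E.
Qed.

Lemma restr_point q : proj_point (restr_ker q.+1).
Proof.
split.
- split=> [||a f g]; rewrite !restr_kerE ?comp_mpoly0 ?comp_mpoly1 ?oner_eq0 //.
  by move=> /eqP e1 /eqP e2; rewrite comp_mpolyD rmorphM /= e1 e2 mulr0 addr0.
- by move=> f g; rewrite !restr_kerE rmorphM /= mulf_eq0.
- move=> f d; rewrite !restr_kerE => /restr_eq0P hf; apply/restr_eq0P => y.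
  apply: (pihomog_vanish _ k0) => t _.
  rewrite -[RHS](hf (fun l => t * y l)); apply: meval_eq => j.
  rewrite -Fhom; apply: Fext => x; rewrite /L big_distrr.
  by apply: eq_bigr => l _; exact: mulrA.
exists j0; rewrite !restr_kerE; apply/negP => /restr_eq0P /(_ (fun l => (l == ord0)%:R)).
rewrite mevalXU => e; case/eqP: F0; rewrite -[RHS]e; apply: Fext => x.
rewrite /L big_ord_recl eqxx mul1r big1 ?addr0 // => l _.
by rewrite mul0r.
Qed.

Lemma prime_chain_exists : prime_chain A D.-1.
Proof.
exists (fun i => restr_ker (D.-1 - i).+1); split=> i hi.
  split; first exact: restr_point.
  move=> d f hf fA; rewrite restr_kerE; apply/restr_eq0P => y; exact: FA hf fA _.
have -> : (D.-1 - i = (D.-1 - i.+1).+1)%N by lia.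
set q := (D.-1 - i.+1).+1; have qD : (q.+1 <= D)%N by lia.
split.
  move=> f; rewrite !restr_kerE => /restr_eq0P hf; apply/restr_eq0P => y.
  rewrite -[RHS](hf (fun l => if insub (val l) is Some l' then y l' else 0)).
  apply: meval_eq => j; apply: Fext => x; rewrite /L [RHS]big_ord_recr /=.
  rewrite insubF ?ltnn // mul0r addr0; apply: eq_bigr => l _; cbv beta.
  by rewrite [insub _](valK l).
pose Lf (b : 'I_q.+1) : {mpoly K[n]} := \sum_j B j b *: 'X_j.
have LfE b v : (Lf b).@[v] = \sum_j B j b * v j.
  by rewrite raddf_sum; apply: eq_bigr => j _; rewrite /= mevalZ mevalXU.
have [g g0 gG] := algebraic_relation [tuple Lf b \mPo Phi q | b < q.+1] (ltnSn q).
have gE v : (g \mPo [tuple Lf b | b < q.+1]).@[v] = g.@[fun b => \sum_j B j b * v j].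
  by rewrite comp_mpoly_meval; apply: meval_eq => b; rewrite tnth_mktuple LfE.
exists (g \mPo [tuple Lf b | b < q.+1]); rewrite restr_kerE.
  apply/restr_eq0P => y; rewrite gE.
  have := congr1 (meval y) gG; rewrite meval0 comp_mpoly_meval => e; rewrite -[RHS]e.
  apply: meval_eq => b; rewrite tnth_mktuple comp_mpoly_meval LfE.
  by apply: eq_bigr => j _; rewrite PhiE.
apply/negP => /restr_eq0P h.
have [|z [y zE]] := @jet_nonzero _ charK0 _
  (fun z => exists y, z =1 fun b : 'I_q.+1 => \sum_j B j b * F (L (y : 'I_q.+1 -> K)) j)
  (fun b => \sum_j B j b * F (u 0%N) j) _ g g0; last first.
  by rewrite (meval_eq _ zE) -gE h eqxx.
move=> w; have [R hR] := Fjet w.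
exists (fun b : 'I_q.+1 => \sum_j B j b *: R j) => t.
(* The curve starts at the coordinates of u 0. *)
exists (fun l => (l == ord0)%:R + t * w l) => b.
have -> : \sum_j B j b * F (L (fun l => (l == ord0)%:R + t * w l)) j =
   \sum_j (B j b * F (u 0%N) j + t * (B j b * \sum_(l < q.+1) w l * J l j)
            + t ^+ 2 * (B j b * (R j).[t])).
  apply: eq_bigr => j _; rewrite -!(mulrCA (B j b)) -!mulrDr.
  congr (_ * _); rewrite -hR; apply: Fext => x; rewrite /L.
  rewrite big_ord_recl eqxx mulrDl mul1r -addrA; congr (_ + _).
  rewrite big_distrr [RHS]big_ord_recl /=; congr (_ + _); first by rewrite mulrA.
  by apply: eq_bigr => l _; rewrite add0r mulrA.
rewrite !big_split /= -!big_distrr /=; congr (_ + _ * _ + _ * _).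
  under [RHS]eq_bigr => j _ do rewrite big_distrr.
  rewrite exchange_big (bigD1 b) //= [X in _ + X]big1 ?addr0 => [|l ne].
    under eq_bigr => j _ do rewrite mulrCA.
    rewrite -big_distrr /= -[LHS]mulr1; congr (_ * _).
    under eq_bigr => j _ do rewrite mulrC.
    rewrite Jind ?eqxx //; apply: leq_trans qD; exact: ltn_ord.
  under eq_bigr => j _ do rewrite mulrCA.
  rewrite -big_distrr /=; under eq_bigr => j _ do rewrite mulrC.
  rewrite Jind; [|exact: leq_trans (ltn_ord _) qD|exact: leq_trans (ltn_ord _) qD].
  by rewrite -[(_ == _)]/(l == b) (negPf ne) mulr0.
by rewrite horner_sum; apply: eq_bigr => j _; rewrite hornerZ.
Qed.
End ChainExists.
End Dimension.

(** * Tangent spaces of Segre cones and their annihilators *)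

(** Multi-indices as nested pairs, so that the last tensor factor splits off by
    computation. *)
Fixpoint ix (n k : nat) : finType :=
  match k with
  | 0 => (unit : finType)
  | k'.+1 => ((ix n k' * 'I_n.+1)%type : finType)
  end.

Fixpoint pt (R : comNzRingType) (n k : nat) (x : nat -> nat -> R) : ix n k -> R :=
  match k return ix n k -> R with
  | 0 => fun _ => 1
  | k'.+1 => fun j => pt x j.1 * x k' j.2
  end.

Definition bra (K : fieldType) (I : finType) (phi v : I -> K) : K :=
  \sum_i phi i * v i.

Section Tangents.
Variables (K : fieldType) (n : nat).
Implicit Types (k c : nat) (x : nat -> nat -> K).

Definition contract k c (phi : ix n k * 'I_c -> K) (w : nat -> K) (j : ix n k) : K :=
  \sum_(l < c) phi (j, l) * w l.

(** The fibre at x is pt x times K^c; it is the part of the tangent space at any point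
    pt x times w that does not depend on w. *)
Definition fiber_kill k c (phi : ix n k * 'I_c -> K) x : Prop :=
  forall l, bra (fun j => phi (j, l)) (pt x) = 0.

(** phi vanishes on the tangent space to the Segre cone at pt x: by the Leibniz
    rule that space is pt x times V plus (tangent space in k-1 factors) times the
    last vector of x. *)
Fixpoint tangent_kill k x : (ix n k -> K) -> Prop :=
  match k return (ix n k -> K) -> Prop with
  | 0 => fun _ => True
  | k'.+1 => fun phi => fiber_kill phi x /\ tangent_kill x (contract phi (x k'))
  end.

(** The same for the Segre cone of k factors V and one factor K^c, whose coordinate
    vector is x k. *)
Definition block_kill k c x (phi : ix n k * 'I_c -> K) : Prop :=
  fiber_kill phi x /\ tangent_kill x (contract phi (x k)).

(** Ranks are bounded from below through annihilators, because those of a direct sum of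
    blocks are found block by block.  That the annihilator has dimension at most e is
    expressed by e further functionals G that determine its elements. *)
Definition defect k c t r e : Prop :=
  exists (p q : nat -> nat -> nat -> K) (G : nat -> ix n k * 'I_c -> K),
  forall phi : ix n k * 'I_c -> K,
    (forall a, (a < t)%N -> block_kill (p a) phi) ->
    (forall a, (a < r)%N -> fiber_kill phi (q a)) ->
    (forall i, (i < e)%N -> bra phi (G i) = 0) ->
    forall j, phi j = 0.

Definition tangent_defect k s e : Prop :=
  exists (p : nat -> nat -> nat -> K) (G : nat -> ix n k -> K),
  forall phi : ix n k -> K,
    (forall a, (a < s)%N -> tangent_kill (p a) phi) ->
    (forall i, (i < e)%N -> bra phi (G i) = 0) ->
    forall j, phi j = 0.

Lemma braD (I : finType) (phi psi v : I -> K) (c : K) :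
  bra (fun i => phi i + c * psi i) v = bra phi v + c * bra psi v.
Proof.
rewrite /bra big_distrr -big_split; apply: eq_bigr => i _ /=.
by rewrite mulrDl mulrA.
Qed.

Lemma bra0 (I : finType) (v : I -> K) : bra (fun _ => 0) v = 0.
Proof. by apply: big1 => i _; rewrite mul0r. Qed.

Lemma bra_delta (I : finType) (phi : I -> K) i : bra phi (fun j => (j == i)%:R) = phi i.
Proof.
rewrite /bra (bigD1 i) //= eqxx mulr1 big1 ?addr0 // => j ne.
by rewrite (negPf ne) mulr0.
Qed.

Lemma bra_block k c (phi : ix n k * 'I_c -> K) (v : ix n k -> K) (w : nat -> K) :
  bra phi (fun jl => v jl.1 * w jl.2) = bra (contract phi w) v.
Proof.
rewrite /bra /contract [LHS](eq_bigr (fun p => phi (p.1, p.2) * (v p.1 * w p.2))); last by case.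
rewrite -(pair_bigA _ (fun j (l : 'I_c) => phi (j, l) * (v j * w l))) /=.
apply: eq_bigr => j _; rewrite big_distrl; apply: eq_bigr => l _ /=.
by rewrite mulrA mulrAC.
Qed.

Lemma bra_contract k c (phi : ix n k * 'I_c -> K) (v : ix n k -> K) (w : nat -> K) :
  bra (contract phi w) v = \sum_(l < c) bra (fun j => phi (j, l)) v * w l.
Proof.
rewrite /bra /contract; under eq_bigr => j _ do rewrite big_distrl /=.
rewrite exchange_big; apply: eq_bigr => l _; rewrite big_distrl; apply: eq_bigr => j _ /=.
exact: mulrAC.
Qed.

Lemma contract_delta k c (phi : ix n k * 'I_c -> K) (l0 : 'I_c) :
  contract phi (fun l => (l == l0)%:R) = (fun j => phi (j, l0)).
Proof.
apply: functional_extensionality => j.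
rewrite /contract (bigD1 l0) //= eqxx mulr1 big1 ?addr0 // => l ne.
by rewrite (_ : (l == l0 :> nat) = false) ?mulr0 //; apply/negbTE.
Qed.

Lemma contractD k c (phi psi : ix n k * 'I_c -> K) a w :
  contract (fun i => phi i + a * psi i) w = (fun j => contract phi w j + a * contract psi w j).
Proof.
apply: functional_extensionality => j.
rewrite /contract big_distrr -big_split; apply: eq_bigr => l _ /=.
by rewrite mulrDl mulrA.
Qed.

Lemma tangent_killD k x (phi psi : ix n k -> K) a :
  tangent_kill x phi -> tangent_kill x psi -> tangent_kill x (fun j => phi j + a * psi j).
Proof.
elim: k phi psi => //= k IH phi psi [f1 t1] [f2 t2]; split.
  by move=> l; rewrite braD f1 f2 mulr0 addr0.
by rewrite contractD; apply: IH.
Qed.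

Lemma fiber_killD k c x (phi psi : ix n k * 'I_c -> K) a :
  fiber_kill phi x -> fiber_kill psi x -> fiber_kill (fun j => phi j + a * psi j) x.
Proof. by move=> f1 f2 l; rewrite braD f1 f2 mulr0 addr0. Qed.

Lemma block_killD k c x (phi psi : ix n k * 'I_c -> K) a :
  block_kill x phi -> block_kill x psi -> block_kill x (fun j => phi j + a * psi j).
Proof.
move=> [f1 t1] [f2 t2]; split; first exact: fiber_killD.
by rewrite contractD; apply: tangent_killD.
Qed.

Lemma contract0 k c (phi : ix n k * 'I_c -> K) w :
  (forall l, (l < c)%N -> w l = 0) -> contract phi w = fun _ => 0.
Proof.
by move=> w0; apply: functional_extensionality => j; apply: big1 => l _; rewrite w0 ?mulr0.
Qed.

Lemma tangent_kill0 k x : tangent_kill x (fun _ : ix n k => 0).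
Proof.
elim: k => //= k IH; split; first by move=> l; apply: bra0.
have -> // : contract (fun _ : ix n k * 'I_n.+1 => 0) (x k) = (fun=> 0).
by apply: functional_extensionality => j; apply: big1 => l _; rewrite mul0r.
Qed.

Lemma eq_pt k x x' : (forall i l, (i < k)%N -> x i l = x' i l) ->
  pt x = pt x' :> (ix n k -> K).
Proof.
elim: k => //= k IH h; apply: functional_extensionality => j /=.
by rewrite IH ?h // => i l hi; apply: h; apply: ltnW.
Qed.

Lemma eq_tangent_kill k x x' : (forall i l, (i < k)%N -> x i l = x' i l) ->
  forall phi : ix n k -> K, tangent_kill x phi -> tangent_kill x' phi.
Proof.
elim: k => //= k IH h phi [f t].
have h' i l : (i < k)%N -> x i l = x' i l by move=> hi; apply: h; apply: ltnW.
split; first by move=> l; rewrite -(eq_pt h').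
have -> : x' k = x k by apply: functional_extensionality => l; rewrite h.
exact: IH t.
Qed.

Lemma eq_fiber_kill k c x x' (phi : ix n k * 'I_c -> K) :
  (forall i l, (i < k)%N -> x i l = x' i l) -> fiber_kill phi x -> fiber_kill phi x'.
Proof. by move=> h f l; rewrite -(eq_pt h). Qed.

Fixpoint ix_coord k : ix n k -> nat -> nat :=
  match k return ix n k -> nat -> nat with
  | 0 => fun _ _ => 0%N
  | k'.+1 => fun j i => if i == k' then (j.2 : nat) else ix_coord j.1 i
  end.

Lemma pt_coord k (j0 : ix n k) :
  pt (fun i l => (l == ix_coord j0 i)%:R : K) = (fun j => (j == j0)%:R).
Proof.
elim: k j0 => [|k IH] j0; apply: functional_extensionality => j.
  by case: j j0 => [] [].
rewrite /= eqxx; have -> : pt (fun i l => (l == (if i == k then (j0.2 : nat) else ix_coord j0.1 i))%:R) j.1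
   = (j.1 == j0.1)%:R :> K.
  rewrite -[RHS](congr1 (@^~ j.1) (IH j0.1)) /=; apply: (congr1 (@^~ j.1)).
  by apply: eq_pt => i l hi; rewrite (ltn_eqF hi).
by rewrite -natrM mulnb; case: j => j1 j2; case: j0 => j3 j4.
Qed.

Lemma defect_mono k c t r e t' r' e' : (t <= t')%N -> (r <= r')%N -> (e <= e')%N ->
  defect k c t r e -> defect k c t' r' e'.
Proof.
move=> ht hr he [p [q [G H]]]; exists p, q, G => phi h1 h2 h3; apply: H => a ha.
- by apply: h1; apply: leq_trans ht.
- by apply: h2; apply: leq_trans hr.
- by apply: h3; apply: leq_trans he.
Qed.

Lemma defect_drop_fiber k c t r e : defect k c t r.+1 e -> defect k c t r (e + c).
Proof.
move=> [p [q [G H]]].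
exists p, q, (fun i => if (i < e)%N then G i else
  fun jl => pt (q r) jl.1 * ((jl.2 : nat) == (i - e)%N)%:R) => phi h1 h2 h3.
apply: H => // [a|i hi]; last by have := h3 i (ltn_addr _ hi); rewrite hi.
rewrite ltnS leq_eqVlt => /orP [/eqP -> l|]; last exact: h2.
have := h3 (e + l)%N; rewrite ltn_add2l ltn_ord ltnNge leq_addr /= addKn => /(_ isT).
by rewrite (bra_block _ _ (fun m => (m == l :> nat)%:R)) contract_delta.
Qed.

(** Tangent spaces have the expected dimension, at most.  When the last vector of x
    vanishes the fibre conditions alone suffice; otherwise one of them follows from
    the condition at pt x in k factors. *)
Lemma block_tangent_span k c x : (0 < c)%N ->
  (exists g : nat -> ix n k -> K, forall psi,
    (forall i, (i < n * k + 1)%N -> bra psi (g i) = 0) ->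
    bra psi (pt x) = 0 /\ tangent_kill x psi) ->
  exists g : nat -> ix n k * 'I_c -> K, forall phi,
    (forall i, (i < n * k + c)%N -> bra phi (g i) = 0) -> block_kill x phi.
Proof.
move=> c0 [g hg]; case: (boolP [exists l : 'I_c, x k l != 0]) => [/existsP [l0 hl0]|/existsPn z].
  exists (fun i => if (i < n * k + 1)%N then fun jl : ix n k * 'I_c => g i jl.1 * x k jl.2
     else fun jl : ix n k * 'I_c => pt x jl.1 * ((jl.2 : nat) == bump l0 (i - (n * k + 1)))%:R) => phi h.
  have [h1 h2] : bra (contract phi (x k)) (pt x) = 0 /\ tangent_kill x (contract phi (x k)).
    apply: hg => i hi; rewrite -bra_block; have := h i; rewrite hi; apply.
    by apply: leq_trans hi _; rewrite leq_add2l.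
  split => //.
  have fl l : l != l0 -> bra (fun j => phi (j, l)) (pt x) = 0.
    move=> ne; have := h (n * k + 1 + unbump l0 l)%N.
    rewrite [(_ < n * k + 1)%N]ltnNge leq_addr /= addKn unbumpK ?inE //.
    rewrite (bra_block _ _ (fun m => (m == l :> nat)%:R)) contract_delta; apply.
    have := ltn_ord l; have := ltn_ord l0; rewrite /unbump.
    by move: ne; rewrite -(inj_eq val_inj) /=; lia.
  move=> l; case: (eqVneq l l0) => [->|]; last exact: fl.
  move: h1; rewrite bra_contract (bigD1 l0) //= big1 ?addr0 => [/eqP|l' ne].
    by rewrite mulf_eq0 (negPf hl0) orbF => /eqP.
  by rewrite fl ?mul0r.
exists (fun (i : nat) (jl : ix n k * 'I_c) => pt x jl.1 * ((jl.2 : nat) == i)%:R) => phi h; split.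
  move=> l; have := h l; rewrite (bra_block _ _ (fun m => (m == l :> nat)%:R)) contract_delta.
  by apply; apply: leq_trans (ltn_ord l) _; rewrite leq_addl.
rewrite contract0; first exact: tangent_kill0.
by move=> l hl; apply/eqP; rewrite -[_ == _]negbK -[l]/(nat_of_ord (Ordinal hl)) z.
Qed.

Lemma tangent_span k x : exists g : nat -> ix n k -> K, forall psi,
    (forall i, (i < n * k + 1)%N -> bra psi (g i) = 0) ->
    bra psi (pt x) = 0 /\ tangent_kill x psi.
Proof.
elim: k => [|k IH]; first by exists (fun _ => pt x) => psi h; split => //; apply: (h 0%N); rewrite muln0.
have [g hg] := @block_tangent_span k n.+1 x (ltn0Sn n) IH.
exists g => psi h; have [f t] : block_kill x psi by apply: hg => i hi; apply: h; lia.
split; last by split.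
rewrite [LHS](bra_block psi (pt x) (x k)) bra_contract big1 // => l _.
by rewrite f mul0r.
Qed.

(** If the annihilator is nonzero, some decomposable tensor is not killed by it, and
    imposing that tensor lowers its dimension. *)
Lemma defect_add_point k t r e : defect k 1 t r e -> defect k 1 t r.+1 e.-1.
Proof.
case: e => [|e]; first exact: defect_mono.
move=> [p [q [G H]]].
have [[phi0 [[h1 h2 h3] [[j0 l0] nz]]]|none] := classic (exists phi0 : ix n k * 'I_1 -> K,
   [/\ forall a, (a < t)%N -> block_kill (p a) phi0,
       forall a, (a < r)%N -> fiber_kill phi0 (q a) &
       forall i, (i < e)%N -> bra phi0 (G i) = 0] /\ exists j, phi0 j != 0); last first.
  apply: (@defect_mono k 1 t r e) => //; exists p, q, G => phi h1 h2 h3 j.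
  apply/eqP; apply: contraT => nz; case: none; exists phi; split; first by split.
  by exists j.
have aG : bra phi0 (G e) != 0.
  apply: contraNneq nz => z; apply/eqP/H => // i; rewrite ltnS leq_eqVlt.
  by case/orP => [/eqP ->|]; [exact: z | exact: h3].
exists p, (fun a => if a == r then fun i l => (l == ix_coord j0 i)%:R else q a), G => phi g1 g2 g3 j.
pose b := - (bra phi (G e) / bra phi0 (G e)).
have comb : forall j, phi j + b * phi0 j = 0.
  apply: (H (fun j => phi j + b * phi0 j)) => [a ha|a ha|i].
  - by apply: block_killD; [exact: g1|exact: h1].
  - apply: fiber_killD; last exact: h2.
    by have := g2 a (ltnW ha); rewrite ltn_eqF.
  rewrite braD ltnS leq_eqVlt => /orP [/eqP ->|hi]; last by rewrite g3 // h3 // mulr0 addr0.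
  by rewrite mulNr divfK // subrr.
have z0 : phi (j0, l0) = 0.
  by have := g2 r (ltnSn r) l0; rewrite eqxx pt_coord bra_delta.
have b0 : b = 0.
  by have /eqP := comb (j0, l0); rewrite z0 add0r mulf_eq0 (negPf nz) orbF => /eqP.
by have := comb j; rewrite b0 mul0r addr0.
Qed.

Lemma tangent_defect_block k s e : defect k n.+1 s 0 e -> tangent_defect k.+1 s e.
Proof. by move=> [p [q [G H]]]; exists p, G => phi h1 h3; apply: H. Qed.

Lemma block_tangent_defect k s e : tangent_defect k s e -> defect k 1 s 0 e.
Proof.
move=> [p [G H]].
exists (fun a i l => if i == k then (l == 0%N)%:R else p a i l), p, (fun i jl => G i jl.1) => phi h1 _ h3.
have key : forall j, phi (j, ord0) = 0.
  apply: H => [a /h1 [_]|i /h3].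
    rewrite eqxx (contract_delta phi ord0); apply: eq_tangent_kill => i l hi.
    by rewrite (ltn_eqF hi).
  move=> e0; rewrite -[RHS]e0 -(contract_delta phi ord0) -bra_block; apply: eq_bigr => -[j l] _.
  by rewrite (ord1 l) /= mulr1.
by move=> [j l]; rewrite (ord1 l) key.
Qed.

Lemma tangent_defect_mono k t e t' e' : (t <= t')%N -> (e <= e')%N ->
  tangent_defect k t e -> tangent_defect k t' e'.
Proof.
move=> ht he [p [G H]]; exists p, G => phi h1 h3; apply: H => a ha.
- by apply: h1; apply: leq_trans ht.
- by apply: h3; apply: leq_trans he.
Qed.

Lemma tangent_defect_drop k t e : tangent_defect k t.+1 e ->
  tangent_defect k t (e + (n * k + 1)).
Proof.
move=> [p [G H]]; have [g hg] := tangent_span k (p t).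
exists p, (fun i => if (i < e)%N then G i else g (i - e)%N) => phi h1 h3.
apply: H => // [a|i hi]; last by have := h3 i (ltn_addr _ hi); rewrite hi.
rewrite ltnS leq_eqVlt => /orP [/eqP ->|]; last exact: h1.
apply: (proj2 (hg _ _)) => i hi; have := h3 (e + i)%N.
by rewrite ltn_add2l hi ltnNge leq_addr /= addKn => /(_ isT).
Qed.

End Tangents.

(** * Generic choice of points *)

Section Generic.
Variable K : fieldType.
Hypothesis charK0 : [pchar K] =i pred0.
Variable n : nat.

Definition config := nat -> nat -> nat -> K.

Definition line (z1 z2 : config) (t : K) : config :=
  fun a i l => z1 a i l + t * (z2 a i l - z1 a i l).

Lemma line0 z1 z2 : line z1 z2 0 = z1.
Proof. by do 3!apply: functional_extensionality => ?; rewrite /line mul0r addr0. Qed.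

Lemma line1 z1 z2 : line z1 z2 1 = z2.
Proof. by do 3!apply: functional_extensionality => ?; rewrite /line mul1r addrC subrK. Qed.

(** A substitute for Zariski open sets in which only lines between configurations, hence
    univariate polynomials, occur. *)
Definition line_open (U : config -> Prop) : Prop := forall z1 z2 t0,
  U (line z1 z2 t0) -> exists2 q : {poly K}, q != 0 & forall t, q.[t] != 0 -> U (line z1 z2 t).

(** On the line joining a point of U to a point of V, all but finitely many points are
    in both, and K is infinite. *)
Lemma line_openI U V z1 z2 : line_open U -> line_open V -> U z1 -> V z2 ->
  exists2 z, U z & V z.
Proof.
move=> oU oV hU hV.
have [q q0 hq] : exists2 q : {poly K}, q != 0 & forall t, q.[t] != 0 -> U (line z1 z2 t).
  by apply: (oU z1 z2 0); rewrite line0.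
have [r r0 hr] : exists2 q : {poly K}, q != 0 & forall t, q.[t] != 0 -> V (line z1 z2 t).
  by apply: (oV z1 z2 1); rewrite line1.
have /(exists_nonroot charK0) [t] : q * r != 0 by rewrite mulf_neq0.
by rewrite hornerM mulf_eq0 negb_or => /andP [h1 h2]; exists (line z1 z2 t); [exact: hq | exact: hr].
Qed.

Definition line_poly (f : config -> K) : Prop := forall z1 z2,
  exists q : {poly K}, forall t, q.[t] = f (line z1 z2 t).

Lemma line_polyC (c : K) : line_poly (fun _ => c).
Proof. by move=> z1 z2; exists c%:P => t; rewrite hornerC. Qed.

Lemma line_poly_coord a i l : line_poly (fun z => z a i l).
Proof.
move=> z1 z2; exists ((z1 a i l)%:P + 'X * (z2 a i l - z1 a i l)%:P) => t.
by rewrite !(hornerD, hornerM, hornerX, hornerC).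
Qed.

Lemma line_polyM f g : line_poly f -> line_poly g -> line_poly (fun z => f z * g z).
Proof.
move=> hf hg z1 z2; have [p hp] := hf z1 z2; have [q hq] := hg z1 z2.
by exists (p * q) => t; rewrite hornerM hp hq.
Qed.

Lemma line_poly_sum (I : finType) (f : I -> config -> K) :
  (forall i, line_poly (f i)) -> line_poly (fun z => \sum_i f i z).
Proof.
move=> hf z1 z2; have [p hp] := fin_all_exists (fun i => hf i z1 z2).
by exists (\sum_i p i) => t; rewrite horner_sum; apply: eq_bigr => i _; rewrite hp.
Qed.

Lemma line_open_neq0 f : line_poly f -> line_open (fun z => f z != 0).
Proof.
move=> hf z1 z2 t0 h; have [q hq] := hf z1 z2; exists q => [|t]; last by rewrite hq.
by apply: contraNneq h => q0; rewrite -hq q0 horner0.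
Qed.

Lemma line_poly_pt k a (j : ix n k) : line_poly (fun z => pt (z a) j).
Proof.
elim: k j => [|k IH] j /=; first exact: line_polyC.
by apply: line_polyM; [exact: IH | exact: line_poly_coord].
Qed.

(** The form of condition for which separation is an open property of the configuration;
    tangent and fibre conditions are brought into it by the closure lemmas below. *)
Definition poly_linear (I : finType) (P : config -> (I -> K) -> Prop) : Prop :=
  exists (C : finType) (a : C -> I -> config -> K),
    (forall c i, line_poly (a c i)) /\
    (forall z phi, P z phi <-> forall c, bra phi (fun i => a c i z) = 0).

Section Closure.
Variable I : finType.
Implicit Type P Q : config -> (I -> K) -> Prop.

Lemma poly_linear_eq (a : I -> config -> K) : (forall i, line_poly (a i)) ->
  poly_linear (fun z phi => bra phi (fun i => a i z) = 0).
Proof.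
move=> ha; exists (unit : finType), (fun _ => a); split => // z phi.
by split=> [h []|/(_ tt)].
Qed.

Lemma poly_linear_true P : (forall z phi, P z phi) -> poly_linear P.
Proof. by move=> h; exists (void : finType), (fun _ _ _ => 0); split => // -[]. Qed.

Lemma poly_linearI P Q : poly_linear P -> poly_linear Q ->
  poly_linear (fun z phi => P z phi /\ Q z phi).
Proof.
move=> [C [a [ha hP]]] [D [b [hb hQ]]].
exists ((C + D)%type : finType), (fun s => match s with inl c => a c | inr d => b d end).
split=> [[c|d] i //|z phi]; split.
  by move=> [/hP h1 /hQ h2] [c|d]; [exact: h1|exact: h2].
by move=> h; split; [apply/hP => c; exact: (h (inl c)) | apply/hQ => d; exact: (h (inr d))].
Qed.

Lemma poly_linear_iff P Q : (forall z phi, P z phi <-> Q z phi) -> poly_linear P -> poly_linear Q.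
Proof.
move=> h [C [a [ha hP]]]; exists C, a; split => // z phi.
by rewrite -h; exact: hP.
Qed.

Lemma poly_linear_all (T : eqType) (s : seq T) (P : T -> config -> (I -> K) -> Prop) :
  (forall d, d \in s -> poly_linear (P d)) ->
  poly_linear (fun z phi => forall d, d \in s -> P d z phi).
Proof.
elim: s => [|d s IH] h; first exact: poly_linear_true.
apply: (poly_linear_iff _ (poly_linearI (h d (mem_head _ _))
   (IH (fun d' hd' => h d' (mem_behead (s := d :: s) hd'))))) => z phi; split.
  by move=> [h1 h2] d'; rewrite inE => /predU1P [->|]; [exact: h1 | exact: h2].
by move=> h1; split=> [|d' hd']; apply: h1; rewrite inE ?eqxx // hd' orbT.
Qed.

Lemma poly_linear_lt m (P : nat -> config -> (I -> K) -> Prop) :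
  (forall a, poly_linear (P a)) ->
  poly_linear (fun z phi => forall a, (a < m)%N -> P a z phi).
Proof.
move=> h; apply: (poly_linear_iff _ (poly_linear_all (s := iota 0 m) (fun a _ => h a))) => z phi.
by split=> h1 a ha; apply: h1; rewrite ?mem_iota // in ha *.
Qed.

Lemma poly_linear_fin (T : finType) (P : T -> config -> (I -> K) -> Prop) :
  (forall d, poly_linear (P d)) -> poly_linear (fun z phi => forall d, P d z phi).
Proof.
move=> h; apply: (poly_linear_iff _ (poly_linear_all (s := enum T) (fun a _ => h a))) => z phi.
by split=> h1 a; [apply: h1; rewrite mem_enum | move=> _; apply: h1].
Qed.
End Closure.

Lemma bra_comp (I J : finType) (phi : I -> K) (b : I -> J -> K) (v : J -> K) :
  bra (fun j => \sum_i phi i * b i j) v = bra phi (fun i => \sum_j b i j * v j).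
Proof.
rewrite /bra; under eq_bigr => j _ do rewrite big_distrl /=.
rewrite exchange_big; apply: eq_bigr => i _; rewrite big_distrr; apply: eq_bigr => j _ /=.
by rewrite mulrA.
Qed.

Lemma poly_linear_fiber (I : finType) k c a (b : I -> ix n k * 'I_c -> K) :
  poly_linear (fun z phi => fiber_kill (fun jl => \sum_i phi i * b i jl) (z a)).
Proof.
apply: poly_linear_fin => l.
apply: (@poly_linear_iff _ (fun z phi => bra phi (fun i => \sum_j b i (j, l) * pt (z a) j) = 0)).
  by move=> z phi; rewrite (bra_comp _ (fun i j => b i (j, l))).
apply: poly_linear_eq => i; apply: line_poly_sum => j.
by apply: line_polyM; [exact: line_polyC | exact: line_poly_pt].
Qed.

Lemma poly_linear_tangent (I : finType) k a (b : I -> ix n k -> config -> K) :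
  (forall i j, line_poly (b i j)) ->
  poly_linear (fun z phi => tangent_kill (z a) (fun j => \sum_i phi i * b i j z)).
Proof.
elim: k b => [|k IH] b hb; first exact: poly_linear_true.
apply: poly_linearI.
  apply: poly_linear_fin => l.
  apply: (@poly_linear_iff _ (fun z phi => bra phi (fun i => \sum_j b i (j, l) z * pt (z a) j) = 0)).
    by move=> z phi; rewrite (bra_comp _ (fun i j => b i (j, l) z)).
  apply: poly_linear_eq => i; apply: line_poly_sum => j.
  by apply: line_polyM; [exact: hb | exact: line_poly_pt].
apply: (@poly_linear_iff _ (fun z phi => tangent_kill (z a)
   (fun j => \sum_i phi i * (\sum_(l < n.+1) b i (j, l) z * z a k l)))); last first.
  apply: IH => i j; apply: line_poly_sum => l.
  by apply: line_polyM; [exact: hb | exact: line_poly_coord].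
move=> z phi; suff -> : contract (fun j => \sum_i phi i * b i j z) (z a k) =
  (fun j => \sum_i phi i * (\sum_(l < n.+1) b i (j, l) z * z a k l)) by [].
apply: functional_extensionality => j; rewrite /contract.
exact: (bra_comp phi (fun i (l : 'I_n.+1) => b i (j, l) z) (fun l => z a k l)).
Qed.

Lemma bra_id (I : finType) (phi : I -> K) : (fun j => \sum_i phi i * (j == i)%:R) = phi.
Proof.
apply: functional_extensionality => j.
by rewrite -[RHS]bra_delta; apply: eq_bigr => i _; rewrite eq_sym.
Qed.

Lemma poly_linear_fiber_kill k c a :
  poly_linear (fun z (phi : ix n k * 'I_c -> K) => fiber_kill phi (z a)).
Proof.
apply: (poly_linear_iff _ (poly_linear_fiber a (fun i (j : ix n k * 'I_c) => (j == i)%:R))) => z phi.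
by rewrite bra_id.
Qed.

Lemma poly_linear_block_kill k c a :
  poly_linear (fun z (phi : ix n k * 'I_c -> K) => block_kill (z a) phi).
Proof.
apply: poly_linearI; first exact: poly_linear_fiber_kill.
apply: (@poly_linear_iff _ (fun z (phi : ix n k * 'I_c -> K) => tangent_kill (z a)
   (fun j => \sum_i phi i * (\sum_(l < c) ((j, l) == i)%:R * z a k l)))).
  move=> z phi; suff -> : (fun j => \sum_i phi i * (\sum_(l < c) ((j, l) == i)%:R * z a k l))
     = contract phi (z a k) by [].
  apply: functional_extensionality => j; rewrite /contract.
  rewrite -[LHS](bra_comp phi (fun i (l : 'I_c) => ((j, l) == i)%:R) (fun l => z a k l)).
  by apply: eq_bigr => l _; rewrite -[in RHS](bra_id phi).
apply: poly_linear_tangent => i j; apply: line_poly_sum => l.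
by apply: line_polyM; [exact: line_polyC | exact: line_poly_coord].
Qed.

Lemma poly_linear_tangent_kill k a :
  poly_linear (fun z (phi : ix n k -> K) => tangent_kill (z a) phi).
Proof.
apply: (poly_linear_iff _ (poly_linear_tangent (b := fun i j _ => (j == i)%:R) a _)) => [z phi|i j].
  by rewrite bra_id.
exact: line_polyC.
Qed.

Definition separates (I : finType) (P : (I -> K) -> Prop) e (G : nat -> I -> K) : Prop :=
  forall phi, P phi -> (forall i, (i < e)%N -> bra phi (G i) = 0) -> forall j, phi j = 0.

(** Separation is invertibility on one side of the matrix of conditions; a one-sided
    inverse at one point of a line gives a determinant that is not identically zero. *)
Lemma separates_open (I : finType) P e (G : nat -> I -> K) :
  poly_linear P -> line_open (fun z => separates (P z) e G).
Proof.
move=> [C [a [ha hP]]] z1 z2 t0 h0.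
pose S := (C + 'I_e)%type; pose a' (s : S) i z := match s with inl c => a c i z | inr g => G g i end.
have exQ (si : S * I) : exists q : {poly K}, forall t, q.[t] = a' si.1 si.2 (line z1 z2 t).
  by case: si => [[c|g] i]; [exact: ha | exact: line_polyC].
have [Q hQ] := fin_all_exists exQ.
pose M z := \matrix_(i < #|I|, s < #|{: S}|) a' (enum_val s) (enum_val i) z.
have freeP z : row_free (M z) <-> separates (P z) e G.
  have kerE phi : (\row_i phi (enum_val i)) *m M z = 0 <->
      (P z phi /\ forall i, (i < e)%N -> bra phi (G i) = 0).
    have E s : ((\row_i phi (enum_val i)) *m M z) 0 s = bra phi (fun i => a' (enum_val s) i z).
      rewrite mxE /bra (reindex_onto (enum_val (A := I)) enum_rank) => [|i _]; last exact: enum_rankK.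
      apply: eq_big => [i|i _]; rewrite ?enum_valK ?eqxx //.
      by rewrite !mxE.
    split=> [h|[/hP h1 h2]]; last first.
      apply/rowP => s; rewrite E mxE; case: (enum_val s) => [c|g] /=; first exact: h1.
      exact: h2.
    have E' s : bra phi (fun i => a' s i z) = 0 by rewrite -[s]enum_rankK -E h mxE.
    split; first by apply/hP => c; exact: (E' (inl c)).
    by move=> i hi; exact: (E' (inr (Ordinal hi))).
  split=> [fr phi h1 h2 j|sep].
    have /kerE /eqP : P z phi /\ forall i, (i < e)%N -> bra phi (G i) = 0 by [].
    rewrite mulmx_free_eq0 // => /eqP /rowP /(_ (enum_rank j)).
    by rewrite !mxE enum_rankK.
  rewrite -kermx_eq0; apply/rowV0P => v /sub_kermxP vM.
  pose phi i := v 0 (enum_rank i).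
  have ev : v = \row_i phi (enum_val i) by apply/rowP => i; rewrite mxE /phi enum_valK.
  have [h1 h2] : P z phi /\ forall i, (i < e)%N -> bra phi (G i) = 0 by apply/kerE; rewrite -ev.
  by apply/rowP => i; rewrite ev !mxE; apply: sep.
have /row_freeP [B MB] : row_free (M (line z1 z2 t0)) by apply/freeP.
pose Q' : 'M[{poly K}]_(#|I|) := (\matrix_(i, s) Q (enum_val s, enum_val i)) *m map_mx polyC B.
have QE t : (\det Q').[t] = \det (M (line z1 z2 t) *m B).
  rewrite -horner_evalE -det_map_mx map_mxM /=; congr (\det (_ *m _)).
    by apply/matrixP => i s; rewrite !mxE /= /horner_eval hQ.
  by apply/matrixP => i s; rewrite !mxE /= /horner_eval hornerC.
exists (\det Q').
  apply: contraTneq (oner_neq0 K) => q0; rewrite negbK.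
  by have := QE t0; rewrite q0 horner0 MB det1 => <-.
move=> t; rewrite QE => nz; apply/freeP.
have : row_free (M (line z1 z2 t) *m B) by rewrite row_free_unit unitmxE unitfE.
rewrite -!kermx_eq0 => /eqP k0; apply/eqP/eqP; rewrite -submx0 -k0.
by apply/sub_kermxP; rewrite mulmxA mulmx_ker mul0mx.
Qed.
End Generic.

(** * Splitting a factor *)

Section Split.
Variable K : fieldType.
Hypothesis charK0 : [pchar K] =i pred0.
Variable n : nat.

Definition left_point k c (x : nat -> nat -> K) i l : K :=
  if i == k then (if (l < c)%N then x k l else 0) else x i l.
Definition right_point k c (x : nat -> nat -> K) i l : K :=
  if i == k then (if (l < c)%N then 0 else x k (l - c)%N) else x i l.

Section Restrict.
Variables (k c1 c2 : nat) (phi : ix n k * 'I_(c1 + c2) -> K).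
Let phi1 (jl : ix n k * 'I_c1) := phi (jl.1, lshift c2 jl.2).
Let phi2 (jl : ix n k * 'I_c2) := phi (jl.1, rshift c1 jl.2).

Lemma contract_left x : contract phi (left_point k c1 x k) = contract phi1 (x k).
Proof.
apply: functional_extensionality => j; rewrite /contract big_split_ord /=.
rewrite [X in _ + X]big1 ?addr0 => [|l _].
  by apply: eq_bigr => l _; rewrite /left_point eqxx ltn_ord.
by rewrite /left_point eqxx ltnNge leq_addr /= mulr0.
Qed.

Lemma contract_right x : contract phi (right_point k c1 x k) = contract phi2 (x k).
Proof.
apply: functional_extensionality => j; rewrite /contract big_split_ord /=.
rewrite [X in X + _]big1 ?add0r => [|l _].
  by apply: eq_bigr => l _; rewrite /right_point eqxx ltnNge leq_addr /= addKn.
by rewrite /right_point eqxx ltn_ord mulr0.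
Qed.

Lemma fiber_kill_split x : fiber_kill phi x <-> fiber_kill phi1 x /\ fiber_kill phi2 x.
Proof.
split=> [h|[h1 h2] l]; first by split=> l; [exact: (h (lshift _ l)) | exact: (h (rshift _ l))].
by case: (split_ordP l) => m ->; [exact: h1 | exact: h2].
Qed.

Lemma block_kill_left x :
  block_kill (left_point k c1 x) phi -> block_kill x phi1 /\ fiber_kill phi2 x.
Proof.
have e i l : (i < k)%N -> left_point k c1 x i l = x i l.
  by move=> hi; rewrite /left_point (ltn_eqF hi).
move=> [/(eq_fiber_kill e)/fiber_kill_split [h1 h2] t]; split=> //; split=> //.
by rewrite -contract_left; apply: eq_tangent_kill e _ t.
Qed.

Lemma block_kill_right x :
  block_kill (right_point k c1 x) phi -> block_kill x phi2 /\ fiber_kill phi1 x.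
Proof.
have e i l : (i < k)%N -> right_point k c1 x i l = x i l.
  by move=> hi; rewrite /right_point (ltn_eqF hi).
move=> [/(eq_fiber_kill e)/fiber_kill_split [h1 h2] t]; split=> //; split=> //.
by rewrite -contract_right; apply: eq_tangent_kill e _ t.
Qed.
End Restrict.

(** Split K^(c1+c2).  A point whose last vector lies in the first summand imposes its
    tangent space there and a fibre on the other summand.  Both blocks use the same
    first k vectors of all points, which is possible as both conditions are open. *)
Lemma defect_split k c1 c2 t1 t2 r e1 e2 :
  defect K n k c1 t1 (r + t2) e1 -> defect K n k c2 t2 (r + t1) e2 ->
  defect K n k (c1 + c2) (t1 + t2) r (e1 + e2).
Proof.
move=> [p1 [q1 [G1 H1]]] [p2 [q2 [G2 H2]]].
pose P1 (z : config K) (phi : ix n k * 'I_c1 -> K) :=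
  (forall a, (a < t1)%N -> block_kill (z a) phi) /\
  (forall a, (a < r + t2)%N -> fiber_kill phi (z (t1 + a)%N)).
pose P2 (z : config K) (phi : ix n k * 'I_c2 -> K) :=
  (forall a, (a < t2)%N -> block_kill (z (t1 + a)%N) phi) /\
  ((forall a, (a < t1)%N -> fiber_kill phi (z a)) /\
   (forall a, (a < r)%N -> fiber_kill phi (z (t1 + t2 + a)%N))).
have o1 : line_open (fun z => separates (P1 z) e1 G1).
  apply: separates_open; apply: poly_linearI; apply: poly_linear_lt => a.
    exact: poly_linear_block_kill.
  exact: poly_linear_fiber_kill.
have o2 : line_open (fun z => separates (P2 z) e2 G2).
  apply: separates_open; apply: poly_linearI; last apply: poly_linearI;
    apply: poly_linear_lt => a; try exact: poly_linear_fiber_kill.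
  exact: poly_linear_block_kill.
have tF m a : (m + a < m)%N = false by rewrite ltnNge leq_addr.
have [||z U V] := line_openI charK0
    (z1 := fun a => if (a < t1)%N then p1 a else q1 (a - t1)%N)
    (z2 := fun a => if (a < t1)%N then q2 a else
             if (a < t1 + t2)%N then p2 (a - t1)%N else q2 (a - t2)%N) o1 o2.
- move=> phi [h1 h2] h3; apply: H1 => // a ha; first by have := h1 a ha; rewrite ha.
  by have := h2 a ha; rewrite tF addKn.
- move=> phi [h1 [h2 h3]] h4; apply: H2 => // a ha.
    by have := h1 a ha; rewrite tF ltn_add2l ha addKn.
  case: (ltnP a t1) => ha1; first by have := h2 a ha1; rewrite ha1.
  have := h3 (a - t1)%N; have -> : (t1 + t2 + (a - t1) = t2 + a)%N by lia.
  rewrite addKn (_ : (t2 + a < t1)%N = false); last by lia.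
  by rewrite (_ : (t2 + a < t1 + t2)%N = false) ?(addnC t1) ?ltn_add2l; [apply; lia | lia].
exists (fun a => if (a < t1)%N then left_point k c1 (z a) else right_point k c1 (z a)).
exists (fun a => z (t1 + t2 + a)%N).
exists (fun i (jl : ix n k * 'I_(c1 + c2)) => if (i < e1)%N
   then (if split jl.2 is inl l then G1 i (jl.1, l) else 0)
   else (if split jl.2 is inr l then G2 (i - e1)%N (jl.1, l) else 0)) => phi h1 h2 h3.
pose phi1 (jl : ix n k * 'I_c1) := phi (jl.1, lshift c2 jl.2).
pose phi2 (jl : ix n k * 'I_c2) := phi (jl.1, rshift c1 jl.2).
have L a : (a < t1)%N -> block_kill (z a) phi1 /\ fiber_kill phi2 (z a).
  by move=> ha; apply: block_kill_left; have := h1 a (ltn_addr _ ha); rewrite ha.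
have R a : (a < t2)%N -> block_kill (z (t1 + a)%N) phi2 /\ fiber_kill phi1 (z (t1 + a)%N).
  move=> ha; apply: block_kill_right.
  by have := h1 (t1 + a)%N; rewrite ltn_add2l tF; apply.
have F a : (a < r)%N -> fiber_kill phi1 (z (t1 + t2 + a)%N) /\ fiber_kill phi2 (z (t1 + t2 + a)%N).
  by move=> ha; apply/fiber_kill_split; exact: h2.
have bsum (g : ix n k * 'I_(c1 + c2) -> K) :
    bra phi g = bra phi1 (fun jl => g (jl.1, lshift c2 jl.2)) + bra phi2 (fun jl => g (jl.1, rshift c1 jl.2)).
  have bE c (psi f : ix n k * 'I_c -> K) : bra psi f = \sum_j \sum_l psi (j, l) * f (j, l).
    by rewrite (pair_bigA _ (fun j l => psi (j, l) * f (j, l))); apply: eq_bigr => -[].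
  by rewrite !bE -big_split; apply: eq_bigr => j _; rewrite big_split_ord.
have z1 : forall j, phi1 j = 0.
  apply: U => [|i hi].
    split=> a ha; first by case: (L a ha).
    case: (ltnP a t2) => h; first by case: (R a h).
    by have [|] := F (a - t2)%N; [lia | rewrite -addnA subnKC].
  have := h3 i (ltn_addr _ hi); rewrite hi bsum [X in _ + X]big1 ?addr0 => [|jl _].
    move=> e0; rewrite -[RHS]e0; apply: eq_bigr => -[j l] _ /=.
    by rewrite -[lshift c2 l]/(unsplit (inl l)) unsplitK.
  by rewrite /= -[rshift c1 _]/(unsplit (inr _)) unsplitK mulr0.
have z2 : forall j, phi2 j = 0.
  apply: V => [|i hi].
    split; first by move=> a /R [].
    by split=> a; [move/L => [] | move/F => []].
  have := h3 (e1 + i)%N; rewrite ltn_add2l hi tF addKn => /(_ isT).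
  rewrite bsum [X in X + _]big1 ?add0r => [|jl _].
    move=> e0; rewrite -[RHS]e0; apply: eq_bigr => -[j l] _ /=.
    by rewrite -[rshift c1 l]/(unsplit (inr l)) unsplitK.
  by rewrite /= -[lshift c2 _]/(unsplit (inl _)) unsplitK mulr0.
by move=> [j l]; case: (split_ordP l) => m ->; [exact: (z1 (j, m)) | exact: (z2 (j, m))].
Qed.

Lemma defect_pieces k c h t r e : defect K n k c t (r + (h * t - t)) e ->
  defect K n k (h * c) (h * t) r (h * e).
Proof.
move=> H; suff gen m : (m <= h)%N -> defect K n k (m * c) (m * t) (r + (h - m) * t) (m * e).
  by have := gen h (leqnn h); rewrite subnn mul0n addn0.
elim: m => [|m IH] hm.
  by exists (fun _ _ _ => 0), (fun _ _ _ => 0), (fun _ _ => 0) => phi _ _ _ [j []].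
rewrite !mulSn; apply: defect_split; last first.
  apply: defect_mono (IH (ltnW hm)) => //; rewrite -addnA leq_add2l -mulSnr leq_mul2r.
  by apply/orP; right; lia.
apply: defect_mono H => //; rewrite -addnA leq_add2l -mulnDl leq_subLR -mulSn leq_mul2r.
by apply/orP; right; lia.
Qed.

Lemma defect_add_points k t r r' e : defect K n k 1 t r e ->
  defect K n k 1 t (r + r') (e - r').
Proof.
elim: r' => [|r' IH] H; first by rewrite addn0 subn0.
by rewrite addnS subnS; apply: defect_add_point; apply: IH.
Qed.

Lemma defect_drop_fibers k c t r r' e :
  defect K n k c t (r + r') e -> defect K n k c t r (e + r' * c).
Proof.
elim: r' e => [|r' IH] e H; first by rewrite mul0n !addn0 in H *.
by rewrite mulSn addnA; apply: IH; apply: defect_drop_fiber; rewrite -addnS.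
Qed.

Lemma tangent_defect_drops k t t' e : tangent_defect K n k (t + t') e ->
  tangent_defect K n k t (e + t' * (n * k + 1)).
Proof.
elim: t' e => [|t' IH] e H; first by rewrite mul0n !addn0 in H *.
by rewrite mulSn addnA; apply: IH; apply: tangent_defect_drop; rewrite -addnS.
Qed.

End Split.

(** * Three factors: pencils and single matrices *)

Section ThreeFactors.
Variable K : fieldType.
Hypothesis charK0 : [pchar K] =i pred0.
Variable n : nat.
Local Notation N := n.+1.

(** From here on k = 2. *)
Definition triple_point (u v w : nat -> K) (i : nat) : nat -> K :=
  if i is 0 then u else if i is 1 then v else w.

Definition indicator (s : seq nat) (l : nat) : K := (l \in s)%:R.

(** Any c of these vectors are independent.  A form phi of a block becomes an N x N
    matrix of polynomials of degree below c, and pairing with moment a is evaluation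
    at a. *)
Definition moment (a l : nat) : K := a%:R ^+ l.

Lemma sum_indicator (V : lmodType K) (s : seq nat) (f : 'I_N -> V) : uniq s ->
  {in s, forall a, (a < N)%N} ->
  \sum_(i < N) indicator s i *: f i = \sum_(a <- s) f (inord a).
Proof.
elim: s => [|a s IH] /= => [_ _|/andP [has us] hs].
  by rewrite big_nil big1 // => i _; rewrite scale0r.
have ha : (a < N)%N by apply: hs; rewrite mem_head.
rewrite big_cons -IH // => [|b hb]; last by apply: hs; rewrite inE hb orbT.
rewrite (bigD1 (inord a)) //= [in RHS](bigD1 (inord a)) //= inordK //.
rewrite /indicator in_cons eqxx (negPf has) scale1r scale0r add0r; congr (_ + _).
apply: eq_bigr => i ne; rewrite in_cons (_ : (i == a :> nat) = false) //.
by apply: contraNF ne => /eqP <-; rewrite inord_val.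
Qed.

Section Block.
Variable c : nat.
Variable phi : ix n 2 * 'I_c -> K.

Definition entry (i j : 'I_N) : {poly K} := \sum_(l < c) phi (((tt, i), j), l) *: 'X^l.
Definition pent (i j : nat) := entry (inord i) (inord j).

Lemma size_entry i j : (size (entry i j) <= c)%N.
Proof.
apply: leq_trans (size_sum _ _ _) _; apply/bigmax_leqP => l _.
by apply: leq_trans (size_scale_leq _ _) _; rewrite size_polyXn.
Qed.

Lemma horner_entry i j a : (entry i j).[a%:R] = contract phi (moment a) ((tt, i), j).
Proof. by rewrite horner_sum; apply: eq_bigr => l _; rewrite hornerZ hornerXn. Qed.

Lemma entry_eq0 i j : entry i j = 0 -> forall l, phi (((tt, i), j), l) = 0.
Proof.
move=> e l; have := congr1 (fun p : {poly K} => p`_l) e.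
rewrite coef0 coef_sum (bigD1 l) //= coefZ coefXn eqxx mulr1 big1 ?addr0 // => l' ne.
rewrite coefZ coefXn (_ : (l == l' :> nat) = false) ?mulr0 //.
by rewrite eq_sym; apply/negbTE.
Qed.

Lemma block_eq0 : (forall i j, (i < N)%N -> (j < N)%N -> pent i j = 0) -> forall jl, phi jl = 0.
Proof.
move=> h [[[[] i] j] l]; apply: entry_eq0.
by rewrite -[i]inord_val -[j]inord_val; apply: h.
Qed.

Lemma pent_eq0 i j (rs : seq nat) : uniq rs -> (c <= size rs)%N ->
  {in rs, forall a, (pent i j).[a%:R] = 0} -> pent i j = 0.
Proof.
move=> urs hs hr; apply: (@roots_geq_poly_eq0 _ _ [seq a%:R | a <- rs]).
- by apply/allP => _ /mapP [a ha ->]; apply/eqP/hr.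
- by rewrite map_inj_uniq //; exact: natr_inj_char0.
by rewrite size_map; apply: leq_trans hs; apply: size_entry.
Qed.

Lemma sum_ix1 (f : ix n 1 -> K) : \sum_i f i = \sum_(i < N) f (tt, i).
Proof.
rewrite (eq_bigr (fun p => f (p.1, p.2))) => [|[]//].
by rewrite -(pair_bigA _ (fun a b => f (a, b))) /= (big_pred1 tt).
Qed.

Lemma sum_ix2 (f : ix n 2 -> K) : \sum_i f i = \sum_(i < N) \sum_(j < N) f ((tt, i), j).
Proof.
rewrite (eq_bigr (fun p => f (p.1, p.2))) => [|[]//].
by rewrite -(pair_bigA _ (fun a b => f (a, b))) /= sum_ix1.
Qed.

Lemma fiber_read s1 s2 w : uniq s1 -> uniq s2 ->
  {in s1, forall a, (a < N)%N} -> {in s2, forall a, (a < N)%N} ->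
  fiber_kill phi (triple_point (indicator s1) (indicator s2) w) ->
  \sum_(a <- s1) \sum_(b <- s2) pent a b = 0.
Proof.
move=> u1 u2 h1 h2 h.
rewrite -(sum_indicator (fun i => \sum_(b <- s2) entry i (inord b)) u1 h1).
apply/polyP => l; rewrite coef0 coef_sum.
case: (ltnP l c) => hl; last first.
  apply: big1 => i _; rewrite coefZ coef_sum big1 ?mulr0 // => b _.
  by rewrite nth_default //; apply: leq_trans hl; apply: size_entry.
have := h (Ordinal hl); rewrite /bra sum_ix2 => e0; rewrite -[RHS]e0.
apply: eq_bigr => i _; rewrite coefZ -(sum_indicator (entry i) u2 h2) coef_sum big_distrr.
apply: eq_bigr => j _ /=; rewrite coefZ.
have -> : (entry i j)`_l = phi (((tt, i), j), Ordinal hl).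
  rewrite coef_sum (bigD1 (Ordinal hl)) //= coefZ coefXn eqxx mulr1 big1 ?addr0 // => l' ne.
  rewrite coefZ coefXn (_ : (l == l' :> nat) = false) ?mulr0 //.
  by rewrite eq_sym; apply: contraNF ne => /eqP e; apply/eqP/val_inj.
by rewrite mul1r mulrA mulrC.
Qed.

Lemma block_read s1 s2 m : uniq s1 -> uniq s2 ->
  {in s1, forall a, (a < N)%N} -> {in s2, forall a, (a < N)%N} ->
  block_kill (triple_point (indicator s1) (indicator s2) (moment m)) phi ->
  [/\ \sum_(a <- s1) \sum_(b <- s2) pent a b = 0,
      forall b, (b < N)%N -> \sum_(a <- s1) (pent a b).[m%:R] = 0
    & forall a, (a < N)%N -> \sum_(b <- s2) (pent a b).[m%:R] = 0].
Proof.
move=> u1 u2 h1 h2 [f [t1 [t2 _]]]; split; first exact: fiber_read f.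
  move=> b hb; rewrite -(sum_indicator (fun i => (entry i (inord b)).[m%:R] : K^o) u1 h1).
  have := t1 (inord b); rewrite /bra sum_ix1 => e0; rewrite -[RHS]e0.
  by apply: eq_bigr => i _; rewrite horner_entry /= mul1r mulrC.
move=> a ha; rewrite -(sum_indicator (fun j => (entry (inord a) j).[m%:R] : K^o) u2 h2).
have := t2 (inord a); rewrite /bra (big_pred1 tt) => [|[] //].
rewrite /= mulr1 => e0; rewrite -[RHS]e0.
by apply: eq_bigr => i _; rewrite horner_entry mulrC.
Qed.

Lemma pent_functional i j m : (i < N)%N -> (j < N)%N ->
  bra phi (fun jl => (jl.1 == ((tt, inord i), inord j))%:R * moment m jl.2) = (pent i j).[m%:R].
Proof.
move=> hi hj.
by rewrite (bra_block phi (fun k => (k == ((tt, inord i), inord j))%:R)) bra_delta horner_entry.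
Qed.
End Block.

Definition diagonal_point a := triple_point (indicator [:: a]) (indicator [:: a]) (moment a).
Definition list_fiber (Fs : seq (seq nat * seq nat)) a :=
  let f := nth ([::], [::]) Fs a in
  triple_point (indicator f.1) (indicator f.2) (moment 0).

Lemma diagonal_read c (phi : ix n 2 * 'I_c -> K) a : (a < N)%N ->
  block_kill (diagonal_point a) phi ->
  [/\ pent phi a a = 0, forall b, (b < N)%N -> (pent phi a b).[a%:R] = 0
    & forall b, (b < N)%N -> (pent phi b a).[a%:R] = 0].
Proof.
move=> ha; have hs : {in [:: a], forall b, (b < N)%N} by move=> b; rewrite inE => /eqP ->.
case/block_read => // e1 e2 e3; split.
- by move: e1; rewrite !big_seq1.
- by move=> b hb; have := e2 b hb; rewrite big_seq1.
- by move=> b hb; have := e3 b hb; rewrite big_seq1.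
Qed.

Definition good_fiber (f : seq nat * seq nat) :=
  [&& uniq f.1, uniq f.2, all (fun a => (a < N)%N) f.1 & all (fun a => (a < N)%N) f.2].

Lemma list_fiber_read c (phi : ix n 2 * 'I_c -> K) Fs :
  all good_fiber Fs ->
  (forall a, (a < size Fs)%N -> fiber_kill phi (list_fiber Fs a)) ->
  forall f, f \in Fs -> \sum_(a <- f.1) \sum_(b <- f.2) pent phi a b = 0.
Proof.
move=> gF h f hf; have /and4P [u1 u2 /allP h1 /allP h2] := allP gF f hf.
have hi : (index f Fs < size Fs)%N by rewrite index_mem.
by have := h _ hi; rewrite /list_fiber nth_index //; apply: fiber_read.
Qed.

(** Take tangent spaces at e_a (x) e_a (x) (1, a), a < t.  They kill the entries (i, j) with
    i, j < t, which have the roots i and j, and leave one scalar in each entry with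
    exactly one index below t.  A fibre at (e_i + e_j) (x) (e_j + e_(sg i)) equates the
    entry (i, j), with root i, to minus the entry (j, sg i), with root sg i <> i, so
    both vanish.  For t = 1 there is no such shift sg. *)
Lemma pencil_defect t : (1 < t)%N -> (t <= N)%N -> defect K n 2 2 t (N * (N - t)) 0.
Proof.
move=> t1 tN.
(* A permutation of the indices below t without fixed point. *)
pose sg i := if i.+1 == t then 0%N else i.+1.
pose Fs := [seq ([:: i], [:: j]) | i <- iota t (N - t), j <- iota t (N - t)] ++
           [seq ([:: i; j], [:: j; sg i]) | i <- iota 0 t, j <- iota t (N - t)].
have sgt i : (i < t)%N -> (sg i < t)%N by rewrite /sg; case: eqP; lia.
have gF : all good_fiber Fs.
  apply/allP => f; rewrite mem_cat => /orP [] /allpairsP [[i j] /=];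
    rewrite !mem_iota /good_fiber => -[hi hj ->] /=; rewrite ?inE ?andbT.
    by lia.
  have := sgt i; rewrite (_ : (j == sg i) = false) 1?(_ : (i == j) = false); first by lia.
    by lia.
  by apply/eqP => e; have := sgt i; lia.
have sF : size Fs = (N * (N - t))%N.
  by rewrite size_cat !size_allpairs !size_iota -mulnDl subnK.
exists diagonal_point, (list_fiber Fs), (fun _ _ => 0) => phi h1 h2 _.
rewrite -sF in h2; have hF := list_fiber_read gF h2.
have D a (ha : (a < t)%N) := diagonal_read (leq_trans ha tN) (h1 a ha).
have low i j : (i < t)%N -> (j < t)%N -> pent phi i j = 0.
  move=> hi hj; case: (eqVneq i j) => [<-|ne]; first by case: (D i hi).
  apply: (@pent_eq0 _ _ _ _ [:: i; j]) => //=; first by rewrite inE ne.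
  move=> a; rewrite !inE => /orP [] /eqP ->.
    by case: (D i hi) => _ + _; apply; apply: leq_trans tN.
  by case: (D j hj) => _ _; apply; apply: leq_trans tN.
have high i j : (t <= i < N)%N -> (t <= j < N)%N -> pent phi i j = 0.
  move=> hi hj; have /hF : ([:: i], [:: j]) \in Fs.
    by rewrite mem_cat allpairs_f // mem_iota subnKC.
  by rewrite !big_seq1.
have mixed i j : (i < t)%N -> (t <= j < N)%N -> pent phi i j = 0 /\ pent phi j (sg i) = 0.
  move=> hi hj; have /hF : ([:: i; j], [:: j; sg i]) \in Fs.
    by rewrite mem_cat (allpairs_f (fun i j => ([:: i; j], [:: j; sg i]))) ?orbT // mem_iota ?subnKC.
  rewrite !big_cons !big_nil !addr0 /= (low i (sg i)) ?sgt // (high j j) // addr0 add0r.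
  move=> e; have e' : pent phi i j = - pent phi j (sg i) by apply/eqP; rewrite -subr_eq0 opprK e.
  have z : pent phi i j = 0.
    apply: (@pent_eq0 _ _ _ _ [:: i; sg i]) => //=.
      by rewrite inE andbT /sg; case: (eqVneq i.+1 t); lia.
    move=> a; rewrite !inE => /orP [] /eqP ->.
      by case: (D i hi) => _ + _; apply; case/andP: hj.
    rewrite e' hornerN; case: (D (sg i) (sgt i hi)) => _ _ ->; first by rewrite oppr0.
    by case/andP: hj.
  by split=> //; apply/eqP; rewrite -oppr_eq0 -e' z.
apply: block_eq0 => i j hi hj.
case: (ltnP i t) => ti; case: (ltnP j t) => tj; first exact: low.
- by case: (mixed i j) => //; rewrite tj.
- pose i' := if j == 0%N then t.-1 else j.-1.
  have hi' : (i' < t)%N by rewrite /i'; case: eqP; lia.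
  have -> : j = sg i'.
    rewrite /sg /i'; case: (eqVneq j 0%N) => [->|j0]; first by rewrite prednK ?eqxx // ltnW.
    by rewrite prednK ?lt0n // (ltn_eqF tj).
  by case: (mixed i' i) => //; rewrite ti.
- by apply: high; apply/andP.
Qed.

(** The tangent spaces at e_a (x) e_a overlap, but kill all entries outside a square of
    side N - t, whose entries are killed one by one. *)
Lemma matrix_defect t r : (t <= N)%N -> ((N - t) ^ 2 <= r)%N -> defect K n 2 1 t r 0.
Proof.
move=> tN hr; apply: (@defect_mono K n 2 1 t ((N - t) ^ 2) 0) => //.
pose Fs := [seq ([:: i], [:: j]) | i <- iota t (N - t), j <- iota t (N - t)].
have gF : all good_fiber Fs.
  apply/allP => f /allpairsP [[i j] /=].
  by rewrite !mem_iota /good_fiber => -[hi hj ->] /=; rewrite ?inE ?andbT; lia.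
have sF : size Fs = ((N - t) ^ 2)%N by rewrite size_allpairs !size_iota.
exists diagonal_point, (list_fiber Fs), (fun _ _ => 0) => phi h1 h2 _.
rewrite -sF in h2; have hF := list_fiber_read gF h2.
have D a (ha : (a < t)%N) := diagonal_read (leq_trans ha tN) (h1 a ha).
apply: block_eq0 => i j hi hj.
case: (ltnP i t) => ti.
  apply: (@pent_eq0 _ _ _ _ [:: i]) => //= a; rewrite inE => /eqP ->.
  by case: (D i ti) => _ + _; apply.
case: (ltnP j t) => tj.
  apply: (@pent_eq0 _ _ _ _ [:: j]) => //= a; rewrite inE => /eqP ->.
  by case: (D j tj) => _ _; apply.
have /hF : ([:: i], [:: j]) \in Fs by rewrite allpairs_f // mem_iota subnKC ?ti ?tj.
by rewrite !big_seq1.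
Qed.

End ThreeFactors.

(** * Three factors: nets and directed triple systems *)

Local Close Scope ring_scope.

Lemma modn_eq q m y x : y < m -> x = q * m + y -> x %% m = y.
Proof. by move=> hy ->; rewrite modnMDl modn_small. Qed.

Lemma progression_step m x w : x < m -> w < m -> x != w ->
  exists2 d, 0 < d < m & (x + d) %% m = w.
Proof.
move=> hx hw ne; case: (ltnP x w) => h.
  by exists (w - x); [lia | apply: (@modn_eq 0); lia].
by exists (w + m - x); [lia | apply: (@modn_eq 1); lia].
Qed.

Lemma progression_outer m x y : odd m -> x < m -> y < m -> x != y ->
  exists2 d, 0 < d < m & (x + 2 * d) %% m = y.
Proof.
move=> om hx hy ne; have [e he xe] := progression_step hx hy ne.
have := xe; rewrite (divn_eq (x + e) m) modnMDl modn_mod => ye.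
have e1 : x + e = (x + e) %/ m * m + y by rewrite [LHS](divn_eq _ m) xe.
case: (boolP (odd e)) => oe.
  exists ((e + m)./2); first by have := odd_double_half (e + m); rewrite oddD oe om -muln2 /=; lia.
  apply: (@modn_eq ((x + e) %/ m).+1) => //.
  by have := odd_double_half (e + m); rewrite oddD oe om -muln2 /= mulSn; lia.
exists (e./2); first by have := odd_double_half e; rewrite (negPf oe) -muln2 /=; lia.
apply: (@modn_eq ((x + e) %/ m)) => //.
by have := odd_double_half e; rewrite (negPf oe) -muln2 /=; lia.
Qed.

Lemma progression_back m w y : w < m -> y < m -> w != y ->
  exists x d, [/\ x < m, 0 < d < m, (x + d) %% m = w & (x + 2 * d) %% m = y].
Proof.
move=> hw hy ne; have [d hd wd] := progression_step hw hy ne.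
have hx : exists2 x, x < m & (x + d) %% m = w.
  case: (ltnP w d) => h.
    by exists (w + m - d); [lia | apply: (@modn_eq 1); lia].
  by exists (w - d); [lia | apply: (@modn_eq 0); lia].
case: hx => x hx xw; exists x, d; split => //.
by rewrite mul2n -addnn addnA -modnDml xw.
Qed.

Lemma progression_neq m x d : odd m -> x < m -> 0 < d < m -> (x + 2 * d) %% m <> x.
Proof.
move=> om hx hd e.
have : 2 * d = (x + 2 * d) %/ m * m by have := divn_eq (x + 2 * d) m; rewrite e; lia.
case: (_ %/ _)%N => [|[|q]]; [by rewrite mul0n; lia | | by rewrite !mulSn; lia].
by rewrite mul1n => h; have := congr1 odd h; rewrite oddM om.
Qed.

Local Open Scope ring_scope.

Section Nets.
Variable K : fieldType.
Hypothesis charK0 : [pchar K] =i pred0.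
Variable n : nat.
Local Notation N := n.+1.

(** The fibre at (e_a + e_b) (x) (e_b + e_c), attached to the triple with arcs ab, bc, ac. *)
Definition triple_fiber (t : nat * nat * nat) : seq nat * seq nat :=
  ([:: t.1.1; t.1.2], [:: t.1.2; t.2]).

Section Kill.
Variable phi : ix n 2 * 'I_3 -> K.
Hypothesis D : forall a, (a < N)%N -> block_kill (diagonal_point K a) phi.
Local Notation p := (pent phi).

Lemma arc_roots a b : (a < N)%N -> (b < N)%N -> (p a b).[a%:R] = 0 /\ (p a b).[b%:R] = 0.
Proof.
move=> ha hb; split.
  by have [_ h _] := diagonal_read ha (D ha); apply: h.
by have [_ _ h] := diagonal_read hb (D hb); apply: h.
Qed.

Lemma arc_diag a : (a < N)%N -> p a a = 0.
Proof. by move=> ha; have [] := diagonal_read ha (D ha). Qed.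

Lemma arc_third a b c : (a < N)%N -> (b < N)%N -> uniq [:: a; b; c] -> (p a b).[c%:R] = 0 -> p a b = 0.
Proof.
move=> ha hb u hc; apply: (pent_eq0 charK0 u) => // x; rewrite !inE.
have [h1 h2] := arc_roots ha hb.
by case/or3P => /eqP ->.
Qed.

(** The fibre says that the three entries sum to zero.  Each has two of the roots a, b, c;
    evaluating at a gives the third root of the entry (b, c), and then evaluating at b
    that of (a, c). *)
Lemma triple_arcs a b c : (a < N)%N -> (b < N)%N -> (c < N)%N -> uniq [:: a; b; c] ->
  \sum_(x <- (triple_fiber (a, b, c)).1) \sum_(y <- (triple_fiber (a, b, c)).2) p x y = 0 ->
  [/\ p a b = 0, p b c = 0 & p a c = 0].
Proof.
move=> ha hb hc u; rewrite /= !big_cons !big_nil !addr0 arc_diag // add0r => e.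
have ev t : (p a b).[t] + (p a c).[t] + (p b c).[t] = 0 by rewrite -!hornerD e horner0.
have [ab1 ab2] := arc_roots ha hb; have [ac1 ac2] := arc_roots ha hc.
have bc : p b c = 0.
  apply: (@arc_third b c a) => //; first by move: u; rewrite /= !inE; lia.
  by have := ev a%:R; rewrite ab1 ac1 !add0r.
have ac : p a c = 0.
  apply: (@arc_third a c b) => //; first by move: u; rewrite /= !inE; lia.
  by have := ev b%:R; rewrite ab2 bc horner0 addr0 add0r.
by split=> //; move: e; rewrite ac bc !addr0.
Qed.

(** One more tangent space, at (sum of e_i) (x) (sum of e_i) (x) moment N: along each row and
    each column the entries sum to zero at N, which disposes of a last nonzero entry. *)
Section Lines.
Hypothesis ones : block_kill (triple_point (indicator K (iota 0 N)) (indicator K (iota 0 N)) (moment K N)) phi.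

Lemma sum_last (f : nat -> K) b0 : (b0 < N)%N -> (forall b, (b < N)%N -> b != b0 -> f b = 0) ->
  \sum_(b <- iota 0 N) f b = 0 -> f b0 = 0.
Proof.
move=> hb h; rewrite (bigD1_seq b0) ?iota_uniq ?mem_iota // big1_seq => [|b].
  by rewrite /= addr0.
by rewrite mem_iota => /andP [ne hb']; apply: h.
Qed.

Lemma row_rule a b0 : (a < N)%N -> (b0 < N)%N -> a != b0 ->
  (forall b, (b < N)%N -> b != b0 -> p a b = 0) -> p a b0 = 0.
Proof.
move=> ha hb ne h; apply: (@arc_third _ _ N) => //; first by rewrite /= !inE; lia.
have sN : {in iota 0 N, forall x, (x < N)%N} by move=> x; rewrite mem_iota.
have [_ _ /(_ a ha)] := block_read (iota_uniq 0 N) (iota_uniq 0 N) sN sN ones.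
apply: (sum_last (f := fun b => (p a b).[N%:R])) => // b hb' ne'.
by rewrite h // horner0.
Qed.

Lemma column_rule b a0 : (b < N)%N -> (a0 < N)%N -> a0 != b ->
  (forall a, (a < N)%N -> a != a0 -> p a b = 0) -> p a0 b = 0.
Proof.
move=> hb ha ne h; apply: (@arc_third _ _ N) => //; first by rewrite /= !inE; lia.
have sN : {in iota 0 N, forall x, (x < N)%N} by move=> x; rewrite mem_iota.
have [_ /(_ b hb) + _] := block_read (iota_uniq 0 N) (iota_uniq 0 N) sN sN ones.
apply: (sum_last (f := fun a => (p a b).[N%:R])) => // a ha' ne'.
by rewrite h // horner0.
Qed.
End Lines.
End Kill.

Section Design.
Variable m : nat.
Hypothesis om : odd m.

(** A directed triple system on Z/m x Z/3, the pair (x, i) being coded by 3x + i: the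
    triples are (x, i), (x+d, i+1), (x+2d, i) with d <> 0. *)
Definition design : seq (nat * nat * nat) :=
  [seq (3 * xd.1 + i, 3 * ((xd.1 + xd.2) %% m) + i.+1 %% 3, 3 * ((xd.1 + 2 * xd.2) %% m) + i)%N
     | i <- iota 0 3, xd <- [seq (x, d) | x <- iota 0 m, d <- iota 1 m.-1]].

Lemma size_design : size design = (3 * m * m.-1)%N.
Proof. by rewrite !size_allpairs !size_iota mulnA. Qed.

Lemma designP t : reflect (exists i x d, [/\ (i < 3)%N, (x < m)%N, (0 < d < m)%N &
   t = (3 * x + i, 3 * ((x + d) %% m) + i.+1 %% 3, 3 * ((x + 2 * d) %% m) + i)%N]) (t \in design).
Proof.
apply: (iffP allpairsP) => [[[i [x d]] /= [hi /allpairsP [[x' d'] /= [hx hd [-> ->]]] ->]]|].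
  have m0 := prednK (odd_gt0 om); move: hx hd; rewrite !mem_iota => hx hd.
  have {}hi : (i < 3)%N by move: hi; rewrite !inE => /or3P [] /eqP ->.
  by exists i, x', d'; split=> //; lia.
have m0 := prednK (odd_gt0 om); move=> [i [x [d [hi hx hd ->]]]].
exists (i, (x, d)); split=> //; first by rewrite mem_iota.
by apply/allpairsP; exists (x, d); rewrite !mem_iota /=; split=> //; lia.
Qed.

Lemma design_bound a b c : (a, b, c) \in design ->
  [/\ (a < 3 * m)%N, (b < 3 * m)%N, (c < 3 * m)%N & uniq [:: a; b; c]].
Proof.
case/designP => i [x [d [hi hx hd [-> -> ->]]]].
have m0 := odd_gt0 om.
have h1 := ltn_pmod (x + d) m0; have h2 := ltn_pmod (x + 2 * d) m0.
have ne := @progression_neq m x d om hx hd.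
have hi' : (i.+1 %% 3 < 3)%N by rewrite ltn_pmod.
have ni : (i.+1 %% 3 <> i)%N by case: i hi {hi'} => [|[|[|]]].
by move: (_ %% 3)%N hi' ni => i' hi' ni; rewrite /= !inE; split; lia.
Qed.

(** Two of x, x+d, x+2d determine the progression when m is odd.  So every arc between
    points with different first component occurs in a triple. *)
Lemma design_cover (Z : nat -> nat -> Prop) :
  (forall a b c, (a, b, c) \in design -> [/\ Z a b, Z b c & Z a c]) ->
  forall x y i j, (x < m)%N -> (y < m)%N -> x != y -> (i < 3)%N -> (j < 3)%N ->
  Z (3 * x + i)%N (3 * y + j)%N.
Proof.
move=> H x y i j hx hy ne hi hj.
have [-> | -> | ->] : [\/ j = i, j = (i.+1 %% 3)%N | i = (j.+1 %% 3)%N].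
  case: i hi => [|[|[|//]]] _; case: j hj => [|[|[|//]]] _;
    by [constructor 1 | constructor 2 | constructor 3].
- have [d hd e] := progression_outer om hx hy ne.
  by case: (H (3 * x + i) (3 * ((x + d) %% m) + i.+1 %% 3) (3 * y + i))%N => //;
     apply/designP; exists i, x, d; rewrite e.
- have [d hd e] := progression_step hx hy ne.
  by case: (H (3 * x + i) (3 * y + i.+1 %% 3) (3 * ((x + 2 * d) %% m) + i))%N => //;
     apply/designP; exists i, x, d; rewrite e.
have [x' [d [hx' hd e1 e2]]] := progression_back hx hy ne.
by case: (H (3 * x' + j) (3 * x + j.+1 %% 3) (3 * y + j))%N => //;
   apply/designP; exists j, x', d; rewrite e1 e2.
Qed.
End Design.

Lemma good_triple_fiber (a b c : nat) : (a < N)%N -> (b < N)%N -> (c < N)%N -> uniq [:: a; b; c] ->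
  good_fiber n (triple_fiber (a, b, c)).
Proof. by rewrite /good_fiber /= !inE => -> -> ->; lia. Qed.

(** The arcs left by the design join points with the same first component; these are
    the 6m extra functionals. *)
Lemma net_sub_defect m : odd m -> N = (3 * m)%N ->
  defect K n 2 3 N (3 * m * m.-1) (6 * m).
Proof.
move=> om eN; pose Fs := map triple_fiber (design m).
have gF : all (good_fiber n) Fs.
  apply/allP => _ /mapP [[[a b] c] /(design_bound om) [ha hb hc u] ->].
  by apply: good_triple_fiber; rewrite ?eN.
have sF : size Fs = (3 * m * m.-1)%N by rewrite size_map size_design.
pose arcs := [:: (0, 1); (1, 0); (0, 2); (2, 0); (1, 2); (2, 1)]%N.
pose G i := let ij := nth (0%N, 0%N) arcs (i %% 6) in
  fun jl : ix n 2 * 'I_3 => (jl.1 == ((tt, inord (3 * (i %/ 6) + ij.1)), inord (3 * (i %/ 6) + ij.2)))%:R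
      * moment K N jl.2.
exists (diagonal_point K), (list_fiber K Fs), G => phi D h2 h3.
rewrite -sF in h2; have hF := list_fiber_read gF h2.
pose Z a b := pent phi a b = 0.
have cover : forall a b c, (a, b, c) \in design m -> [/\ Z a b, Z b c & Z a c].
  move=> a b c habc; have [ha hb hc u] := design_bound om habc.
  by apply: (triple_arcs D) u _; rewrite ?eN //; apply: hF; apply: map_f.
have small x i j : (x < m)%N -> (i, j) \in arcs -> Z (3 * x + i)%N (3 * x + j)%N.
  move=> hx hij; have [h1 h2'] : (i < 3)%N /\ (j < 3)%N.
    by move: hij; rewrite !inE !xpair_eqE; lia.
  have ne : i != j by move: hij; rewrite !inE !xpair_eqE; lia.
  have [r hr hn] : exists2 r, (r < 6)%N & nth (0%N, 0%N) arcs r = (i, j).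
    by exists (index (i, j) arcs); rewrite ?nth_index //; rewrite -index_mem in hij.
  have := h3 (6 * x + r)%N; rewrite /G.
  have -> : ((6 * x + r) %/ 6 = x)%N by lia.
  have -> : ((6 * x + r) %% 6 = r)%N by lia.
  rewrite hn (pent_functional phi) /=; try lia.
  by move=> e; apply: (@arc_third _ D _ _ N); [lia | lia | rewrite /= !inE; lia | apply: e; lia].
apply: block_eq0 => a b ha hb.
have [va vb] : ((a %/ 3 < m) /\ (b %/ 3 < m))%N by lia.
have [ra rb] : ((a %% 3 < 3) /\ (b %% 3 < 3))%N by lia.
have -> : a = (3 * (a %/ 3) + a %% 3)%N by lia.
have -> : b = (3 * (b %/ 3) + b %% 3)%N by lia.
case: (eqVneq (a %/ 3)%N (b %/ 3)%N) => [<-|ne]; last exact: (design_cover om cover).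
case: (eqVneq (a %% 3)%N (b %% 3)%N) => [<-|ne].
  by apply: (arc_diag D); lia.
apply: small => //; move: ne ra rb.
by case: (a %% 3)%N => [|[|[|]]] //; case: (b %% 3)%N => [|[|[|]]].
Qed.

End Nets.

(** * Three factors: a net filled by one tangent space more *)

(** Two points P and Q are added to Z/m x Z/3.  Five transitive triples on each
    (x, 0), (x, 1), (x, 2), P, Q leave few arcs, and one triple must be saved at x = 0; the
    row and column rules of the additional tangent space remove what is left. *)
Section NetSuper.
Variable K : fieldType.
Hypothesis charK0 : [pchar K] =i pred0.
Variable n : nat.
Local Notation N := n.+1.
Variable m : nat.
Hypothesis om : odd m.
Hypothesis eN : N = (3 * m + 2)%N.

Let P := (3 * m)%N.
Let Q := (3 * m).+1.

Definition star_shapes (x : nat) : seq (nat * nat * nat) :=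
  [:: (3 * x, P, 3 * x + 1); (3 * x + 1, P, 3 * x + 2); (3 * x + 2, P, 3 * x);
      (3 * x + 2, 3 * x + 1, Q)]%N.
Definition star_triples : seq (nat * nat * nat) :=
  flatten [seq star_shapes x | x <- iota 0 m] ++
  [seq (3 * x, Q, 3 * x + 2)%N | x <- iota 1 m.-1].

Lemma size_star_triples : size star_triples = (5 * m - 1)%N.
Proof.
rewrite size_cat size_map size_iota size_flatten /shape -map_comp.
have -> : [seq (size \o star_shapes) x | x <- iota 0 m] = nseq m 4%N.
  by rewrite -[in nseq _ _](size_iota 0 m); elim: (iota 0 m) => //= a s ->.
by rewrite sumn_nseq; have := odd_gt0 om; lia.
Qed.

Lemma star_bound a b c : (a, b, c) \in star_triples ->
  [/\ (a < N)%N, (b < N)%N, (c < N)%N & uniq [:: a; b; c]].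
Proof.
rewrite mem_cat => /orP [/flatten_mapP [x]|/mapP [x]].
  rewrite mem_iota !inE !xpair_eqE /P /Q /= => hx h.
  by rewrite eN; split; move: h; rewrite /= ?inE; lia.
by rewrite mem_iota => hx [-> -> ->]; rewrite eN /Q; split; rewrite /= ?inE; lia.
Qed.

Lemma net_super_defect : defect K n 2 3 N.+1 (3 * m * m.-1 + (5 * m - 1)) 0.
Proof.
have m0 := odd_gt0 om.
pose Fs := map triple_fiber (design m ++ star_triples).
have bound a b c : (a, b, c) \in design m ++ star_triples ->
    [/\ (a < N)%N, (b < N)%N, (c < N)%N & uniq [:: a; b; c]].
  rewrite mem_cat => /orP [/(design_bound om) [ha hb hc u]|/star_bound //].
  by rewrite eN; split=> //; lia.
have gF : all (good_fiber n) Fs.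
  apply/allP => _ /mapP [[[a b] c] /bound [ha hb hc u] ->].
  exact: good_triple_fiber.
have sF : size Fs = (3 * m * m.-1 + (5 * m - 1))%N.
  by rewrite size_map size_cat size_design size_star_triples.
exists (fun a => if (a < N)%N then diagonal_point K a else
  triple_point (indicator K (iota 0 N)) (indicator K (iota 0 N)) (moment K N)).
exists (list_fiber K Fs), (fun _ _ => 0) => phi h1 h2 _.
rewrite -sF in h2; have hF := list_fiber_read gF h2.
have D a : (a < N)%N -> block_kill (diagonal_point K a) phi.
  by move=> ha; have := h1 a (leqW ha); rewrite ha.
have ones : block_kill (triple_point (indicator K (iota 0 N)) (indicator K (iota 0 N)) (moment K N)) phi.
  by have := h1 N (ltnSn N); rewrite ltnn.
pose Z a b := pent phi a b = 0.
have cover a b c : (a, b, c) \in design m ++ star_triples -> [/\ Z a b, Z b c & Z a c].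
  move=> habc; have [ha hb hc u] := bound _ _ _ habc.
  by apply: (triple_arcs charK0 D ha hb hc u); apply: hF; apply: map_f.
have row a b0 : (a < N)%N -> (b0 < N)%N -> a != b0 ->
    (forall b, (b < N)%N -> b != b0 -> Z a b) -> Z a b0.
  exact: (row_rule charK0 D ones).
have col b a0 : (b < N)%N -> (a0 < N)%N -> a0 != b ->
    (forall a, (a < N)%N -> a != a0 -> Z a b) -> Z a0 b.
  exact: (column_rule charK0 D ones).
have star x t : (x < m)%N -> t \in star_shapes x -> t \in design m ++ star_triples.
  move=> hx ht; rewrite !mem_cat; apply/orP; right; apply/orP; left.
  by apply/flatten_mapP; exists x; rewrite ?mem_iota.
have [SA SB SC SE] : [/\
   forall x, (x < m)%N -> [/\ Z (3 * x)%N P, Z P (3 * x + 1)%N & Z (3 * x)%N (3 * x + 1)%N],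
   forall x, (x < m)%N -> [/\ Z (3 * x + 1)%N P, Z P (3 * x + 2)%N & Z (3 * x + 1)%N (3 * x + 2)%N],
   forall x, (x < m)%N -> [/\ Z (3 * x + 2)%N P, Z P (3 * x)%N & Z (3 * x + 2)%N (3 * x)%N] &
   forall x, (x < m)%N -> [/\ Z (3 * x + 2)%N (3 * x + 1)%N, Z (3 * x + 1)%N Q & Z (3 * x + 2)%N Q]].
  by split=> x hx; apply: cover; apply: (star x) => //; rewrite /star_shapes !inE eqxx ?orbT.
have SD x : (0 < x < m)%N -> [/\ Z (3 * x)%N Q, Z Q (3 * x + 2)%N & Z (3 * x)%N (3 * x + 2)%N].
  move=> hx; apply: cover; rewrite !mem_cat; apply/orP; right; apply/orP; right.
  by apply/mapP; exists x => //; rewrite mem_iota; lia.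
have main x y i j : (x < m)%N -> (y < m)%N -> x != y -> (i < 3)%N -> (j < 3)%N ->
    Z (3 * x + i)%N (3 * y + j)%N.
  apply: (design_cover om) => a b c h; apply: cover.
  by rewrite mem_cat h.
have vertex b : (b < N)%N -> [\/ exists y j, [/\ (y < m)%N, (j < 3)%N & b = (3 * y + j)%N],
     b = P | b = Q].
  move=> hb; rewrite /P /Q; have [h|[h|h]] : (b < 3 * m)%N \/ (b = 3 * m \/ b = (3 * m).+1)%N by lia.
  - by constructor 1; exists (b %/ 3)%N, (b %% 3)%N; split; lia.
  - by constructor 2.
  - by constructor 3.
have diag a : (a < N)%N -> Z a a by exact: arc_diag.
have outer_row x i b : (x < m)%N -> (i < 3)%N -> (b < N)%N ->
    (forall j, (j < 3)%N -> b = (3 * x + j)%N -> Z (3 * x + i)%N b) ->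
    (b = P -> Z (3 * x + i)%N b) -> (b = Q -> Z (3 * x + i)%N b) -> Z (3 * x + i)%N b.
  move=> hx hi /vertex [[y [j [hy hj eb]]]|eb|eb] g1 g2 g3; [|exact: g2|exact: g3].
  case: (eqVneq x y) => [exy|ne]; last by rewrite eb; apply: main.
  by apply: (g1 j) => //; rewrite exy.
have outer_col x i b : (x < m)%N -> (i < 3)%N -> (b < N)%N ->
    (forall j, (j < 3)%N -> b = (3 * x + j)%N -> Z b (3 * x + i)%N) ->
    (b = P -> Z b (3 * x + i)%N) -> (b = Q -> Z b (3 * x + i)%N) -> Z b (3 * x + i)%N.
  move=> hx hi /vertex [[y [j [hy hj eb]]]|eb|eb] g1 g2 g3; [|exact: g2|exact: g3].
  case: (eqVneq y x) => [exy|ne]; last by rewrite eb; apply: main.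
  by apply: (g1 j) => //; rewrite -exy.
have t0 x : (3 * x + 0 = 3 * x)%N by rewrite addn0.
(* In each of S1, ..., S8 the entry is the last unknown one of its row or column. *)
have S1 x : (x < m)%N -> Z (3 * x + 1)%N (3 * x)%N.
  move=> hx; apply: row; [lia|lia|lia|] => b hb ne.
  apply: outer_row => // [[|[|[|//]]] _ eb|->|->]; first by lia.
  - by rewrite eb; apply: diag; lia.
  - by rewrite eb; case: (SB x hx).
  - by case: (SB x hx).
  - by case: (SE x hx).
have S2 x : (x < m)%N -> Z Q (3 * x)%N.
  move=> hx; apply: col; rewrite /Q; [lia|lia|lia|] => b hb ne.
  rewrite -(t0 x); apply: outer_col => // [[|[|[|//]]] _ eb|->|eb]; last by lia.
  - by rewrite eb; apply: diag; lia.
  - by rewrite eb t0; apply: S1.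
  - by rewrite eb t0; case: (SC x hx).
  - by rewrite t0; case: (SC x hx).
have S3 x : (x < m)%N -> Z Q (3 * x + 1)%N.
  move=> hx; apply: col; rewrite /Q; [lia|lia|lia|] => b hb ne.
  apply: outer_col => // [[|[|[|//]]] _ eb|->|eb]; last by lia.
  - by rewrite eb t0; case: (SA x hx).
  - by rewrite eb; apply: diag; lia.
  - by rewrite eb; case: (SE x hx).
  - by case: (SA x hx).
have toP x j : (x < m)%N -> (j < 3)%N -> Z (3 * x + j)%N P.
  by move=> hx; case: j => [|[|[|//]]] _; rewrite ?t0; [case: (SA x hx)|case: (SB x hx)|case: (SC x hx)].
have fromP x j : (x < m)%N -> (j < 3)%N -> Z P (3 * x + j)%N.
  by move=> hx; case: j => [|[|[|//]]] _; rewrite ?t0; [case: (SC x hx)|case: (SA x hx)|case: (SB x hx)].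
have S4 : Z Q P.
  apply: col; rewrite /Q /P; [lia|lia|lia|] => b hb ne.
  case: (vertex b hb) => [[y [j [hy hj ->]]]|->|eb]; [exact: toP|apply: diag; rewrite /P; lia|].
  by move: ne; rewrite eb /Q eqxx.
have S5 : Z P Q.
  apply: row; rewrite /Q /P; [lia|lia|lia|] => b hb ne.
  case: (vertex b hb) => [[y [j [hy hj ->]]]|->|eb]; [exact: fromP|apply: diag; rewrite /P; lia|].
  by move: ne; rewrite eb /Q eqxx.
have S6 x : (x < m)%N -> Z Q (3 * x + 2)%N.
  case: x => [|x] hx; last by case: (SD x.+1 hx).
  apply: row; rewrite /Q; [lia|lia|lia|] => b hb ne.
  case: (vertex b hb) => [[y [j [hy hj eb]]]|->|->]; [|exact: S4|apply: diag; rewrite /Q; lia].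
  rewrite eb; case: j hj eb => [|[|[|//]]] _ eb; [by rewrite t0; apply: S2 | by apply: S3 | ].
  by case: y hy eb => [|y] hy eb; [lia | case: (SD y.+1 hy)].
have S7 x : (x < m)%N -> Z (3 * x)%N (3 * x + 2)%N.
  case: x => [|x] hx; last by case: (SD x.+1 hx).
  apply: col; [lia|lia|lia|] => b hb ne.
  apply: outer_col => // [[|[|[|//]]] _ eb|->|->]; first by lia.
  - by rewrite eb; case: (SB 0%N hx).
  - by rewrite eb; apply: diag; lia.
  - by case: (SB 0%N hx).
  - exact: S6.
have S8 x : (x < m)%N -> Z (3 * x)%N Q.
  case: x => [|x] hx; last by case: (SD x.+1 hx).
  apply: row; rewrite /Q; [lia|lia|lia|] => b hb ne.
  rewrite -(t0 0%N); apply: outer_row => // [[|[|[|//]]] _ eb|->|eb]; last by lia.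
  - by rewrite eb; apply: diag; lia.
  - by rewrite eb t0; case: (SA 0%N hx).
  - by rewrite eb t0; apply: S7.
  - by rewrite t0; case: (SA 0%N hx).
apply: block_eq0 => a b /vertex + /vertex.
move=> [[x [i [hx hi ->]]]|->|->] [[y [j [hy hj ->]]]|->|->]; rewrite -/(Z _ _) //.
- case: (eqVneq x y) => [<-|ne]; last exact: main.
  case: i hi => [|[|[|//]]] _; case: j hj => [|[|[|//]]] _; rewrite ?t0.
  + by apply: diag; lia.
  + by case: (SA x hx).
  + exact: S7.
  + exact: S1.
  + by apply: diag; lia.
  + by case: (SB x hx).
  + by case: (SC x hx).
  + by case: (SE x hx).
  + by apply: diag; lia.
- exact: toP.
- case: i hi => [|[|[|//]]] _; rewrite ?t0; [exact: S8|by case: (SE x hx)|by case: (SE x hx)].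
- exact: fromP.
- by apply: diag; rewrite /P; lia.
- case: j hj => [|[|[|//]]] _; rewrite ?t0; [exact: S2|exact: S3|exact: S6].
- by apply: diag; rewrite /Q; lia.
Qed.
End NetSuper.

(** * Three factors: assembling the blocks *)

Local Close Scope ring_scope.

Section Base.
Variable K : fieldType.
Hypothesis charK0 : [pchar K]%R =i pred0.
Variable n : nat.
Local Notation N := n.+1.

Lemma pencil_fibers t r : 1 < t -> t <= N -> defect K n 2 2 t r (2 * (N * (N - t) - r)).
Proof.
move=> t1 tN; have H := pencil_defect charK0 t1 tN.
case: (leqP (N * (N - t)) r) => hr; first exact: defect_mono H.
apply: (@defect_mono K n 2 2 t r (0 + (N * (N - t) - r) * 2)) => //; first by rewrite mulnC.
by apply: (defect_drop_fibers (r' := N * (N - t) - r)); rewrite subnKC // ltnW.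
Qed.

(** h planes carry t tangent spaces each, and the remaining block of dimension c
    carries s. *)
Lemma three_factor_split h c t s e : N = h * 2 + c -> 1 < t -> t <= N ->
  defect K n 2 c s (h * t) e ->
  tangent_defect K n 3 (h * t + s) (h * (2 * (N * (N - t) - (s + (h * t - t)))) + e).
Proof.
move=> eN t1 tN H; apply: tangent_defect_block.
rewrite [X in defect _ _ _ X]eN; apply: (defect_split charK0) => //.
by apply: (defect_pieces charK0); apply: pencil_fibers.
Qed.

Lemma no_block_defect r : defect K n 2 0 0 r 0.
Proof. by exists (fun _ _ _ => 0%R), (fun _ _ _ => 0%R), (fun _ _ => 0%R) => phi _ _ _ [j []]. Qed.

Lemma line_defect r : defect K n 2 1 0 r (N ^ 2 - r).
Proof.
have H : defect K n 2 1 0 (N ^ 2) 0 by apply: (matrix_defect charK0); rewrite ?subn0.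
case: (leqP (N ^ 2) r) => hr; first exact: defect_mono H.
apply: (@defect_mono K n 2 1 0 r (0 + (N ^ 2 - r) * 1)) => //; first by rewrite add0n muln1.
by apply: (defect_drop_fibers (r' := N ^ 2 - r)); rewrite subnKC // ltnW.
Qed.

Lemma tangent_defect_fewer k s s' : s <= s' -> s' * (n * k + 1) <= N ^ k ->
  tangent_defect K n k s' (N ^ k - s' * (n * k + 1)) ->
  tangent_defect K n k s (N ^ k - s * (n * k + 1)).
Proof.
move=> hs hs' H; apply: (@tangent_defect_mono K n k s
   (N ^ k - s' * (n * k + 1) + (s' - s) * (n * k + 1))) => //.
  have h : s * (n * k + 1) <= s' * (n * k + 1) by rewrite leq_mul2r hs orbT.
  by rewrite mulnBl; lia.
by apply: tangent_defect_drops; rewrite subnKC.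
Qed.

(** The differences N - t and N (N - t) - (s + h t) are passed as u and d, so that the
    side conditions are polynomial identities without truncated subtraction. *)
Lemma three_factor_fewer h c t u d s e s' : N = h.+1 * 2 + c -> 1 < t -> N = t + u ->
  N * u = d + (s + h * t) -> defect K n 2 c s (h.+1 * t) e ->
  h.+1 * (2 * d) + e + (h.+1 * t + s) * (n * 3 + 1) = N ^ 3 ->
  s' <= h.+1 * t + s ->
  tangent_defect K n 3 s' (N ^ 3 - s' * (n * 3 + 1)).
Proof.
move=> eN t1 eu ed H e3 hs.
apply: (@tangent_defect_fewer 3 s' (h.+1 * t + s)) => //; first by rewrite -e3 leq_addl.
have tN : t <= N by rewrite eu leq_addr.
have := three_factor_split eN t1 tN H.
have -> : N - t = u by rewrite eu addKn.
by rewrite mulSn addKn ed addnK -mulSn -e3 addnK.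
Qed.

Lemma three_factor_fill h c t u s s' : N = h.+1 * 2 + c -> 1 < t -> N = t + u ->
  N * u <= s + h * t -> defect K n 2 c s (h.+1 * t) 0 -> h.+1 * t + s <= s' ->
  tangent_defect K n 3 s' 0.
Proof.
move=> eN t1 eu ed H hs.
have tN : t <= N by rewrite eu leq_addr.
have := three_factor_split eN t1 tN H.
have -> : N - t = u by rewrite eu addKn.
have /eqP -> : N * u - (s + (h.+1 * t - t)) == 0 by rewrite mulSn addKn subn_eq0.
by rewrite !muln0; apply: tangent_defect_mono.
Qed.

(** About N^2/3: enough for three factors and, unless N = 3, for the first induction
    step, which asks for one tangent space more than N^3 %/ (4n+1). *)
Definition sub3_bound (M : nat) : nat :=
  let m := M %/ 3 in
  match M %% 3 with
  | 0 => 3 * (m * m)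
  | 1 => 3 * (m * m) + m + 1
  | _ => 3 * (m * m) + 3 * m + 2
  end.

Lemma sub3_boundE M m r : r < 3 -> M = m * 3 + r -> sub3_bound M =
  match r with
  | 0 => 3 * (m * m)
  | 1 => 3 * (m * m) + m + 1
  | _ => 3 * (m * m) + 3 * m + 2
  end.
Proof. by move=> hr ->; rewrite /sub3_bound divnMDl // modnMDl modn_small // divn_small // addn0. Qed.
End Base.

Section Cases.
Variable K : fieldType.
Hypothesis charK0 : [pchar K]%R =i pred0.

(** The parity of N decides whether a block is left over, and N mod 3 decides how the
    optimal number of tangent spaces for each plane is rounded. *)
Lemma residue_mod6 n : exists q, [\/ n = 6 * q + 5 \/ n = 6 * q + 3, n = 6 * q + 1,
  n = 6 * q + 2 \/ n = 6 * q | n = 6 * q + 4].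
Proof.
exists (n %/ 6).
have [e|[e|[e|[e|[e|e]]]]] : n = n %/ 6 * 6 + 5 \/ (n = n %/ 6 * 6 + 3 \/ (n = n %/ 6 * 6 + 1 \/
   (n = n %/ 6 * 6 + 2 \/ (n = n %/ 6 * 6 \/ n = n %/ 6 * 6 + 4)))) by lia.
- by constructor 1; left; lia.
- by constructor 1; right; lia.
- by constructor 2; lia.
- by constructor 3; left; lia.
- by constructor 3; right; lia.
- by constructor 4; lia.
Qed.

Lemma three_factor_sub n : 0 < n ->
  tangent_defect K n 3 (sub3_bound n.+1) (n.+1 ^ 3 - sub3_bound n.+1 * (n * 3 + 1)).
Proof.
have [q [[]|| []|]] := residue_mod6 n => -> n0.
- rewrite (@sub3_boundE _ (2 * q + 2) 0) //; last by lia.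
  by apply: (@three_factor_fewer K charK0 _ (3 * q + 2) 0 (4 * q + 4) (2 * q + 2) (4 * q + 4) 0 0);
    [lia | lia | lia | lia | exact: no_block_defect | lia | lia].
- rewrite (@sub3_boundE _ (2 * q + 1) 1) //; last by lia.
  by apply: (@three_factor_fewer K charK0 _ (3 * q + 1) 0 (4 * q + 3) (2 * q + 1) (q + 1) 0 0);
    [lia | lia | lia | lia | exact: no_block_defect | lia | lia].
- rewrite (@sub3_boundE _ (2 * q) 2) //; last by lia.
  case: q n0 => [|p] n0.
    by apply: (@three_factor_fewer K charK0 _ 0 0 2 0 0 0 0);
      [lia | lia | lia | lia | exact: no_block_defect | lia | lia].
  by apply: (@three_factor_fewer K charK0 _ (3 * p + 3) 0 (4 * p + 5) (2 * p + 3) (7 * p + 9) 0 0);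
    [lia | lia | lia | lia | exact: no_block_defect | lia | lia].
- rewrite (@sub3_boundE _ (2 * q + 1) 0) //; last by lia.
  case: q n0 => [|p] n0.
    have H : defect K 2 2 3 3 (0 * 2) 6 by apply: (@net_sub_defect K charK0 2 1).
    by have := @three_factor_split K charK0 2 0 3 2 3 6 erefl isT isT H.
  have H : defect K (6 * p.+1 + 2) 2 3 (6 * p.+1 + 2).+1 ((3 * p + 2).+1 * (4 * p + 6)) (12 * p + 18).
    have -> : 12 * p + 18 = 6 * (2 * p + 3) by lia.
    have -> : (3 * p + 2).+1 * (4 * p + 6) = 3 * (2 * p + 3) * (2 * p + 3).-1 by lia.
    by apply: net_sub_defect => //; lia.
  by apply: (@three_factor_fewer K charK0 _ (3 * p + 2) 3 (4 * p + 6) (2 * p + 3) (4 * p + 6) _ _ _ _ _ _ _ H);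
    lia.
- case: q n0 => [//|p] n0; rewrite (@sub3_boundE _ (2 * p + 2) 1) //; last by lia.
  have H : defect K (6 * p.+1) 2 1 0 ((3 * p + 2).+1 * (4 * p + 5)) (24 * (p * p) + 57 * p + 34).
    have -> : 24 * (p * p) + 57 * p + 34 = (6 * p.+1).+1 ^ 2 - (3 * p + 2).+1 * (4 * p + 5) by lia.
    exact: line_defect.
  by apply: (@three_factor_fewer K charK0 _ (3 * p + 2) 1 (4 * p + 5) (2 * p + 2) (3 * p + 4) _ _ _ _ _ _ _ H);
    lia.
- rewrite (@sub3_boundE _ (2 * q + 1) 2) //; last by lia.
  have H : defect K (6 * q + 4) 2 1 0 ((3 * q + 1).+1 * (4 * q + 4)) (24 * (q * q) + 40 * q + 17).
    have -> : 24 * (q * q) + 40 * q + 17 = (6 * q + 4).+1 ^ 2 - (3 * q + 1).+1 * (4 * q + 4) by lia.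
    exact: line_defect.
  by apply: (@three_factor_fewer K charK0 _ (3 * q + 1) 1 (4 * q + 4) (2 * q + 1) 1 _ _ _ _ _ _ _ H);
    lia.
Qed.

Lemma divn_eq_range a b q : q * b <= a < q.+1 * b -> a %/ b = q.
Proof.
move=> /andP [h1 h2]; apply/eqP; rewrite eqn_leq.
have b0 : 0 < b by rewrite lt0n; apply: contraTneq h2 => ->; rewrite muln0.
by rewrite -ltnS ltn_divLR // h2 leq_divRL.
Qed.

Lemma three_factor_super n : 0 < n ->
  tangent_defect K n 3 (n.+1 * (n.+1 ^ 2 %/ (n * 3 + 1) + 1)) 0.
Proof.
have [q [[]|| []|]] := residue_mod6 n => -> n0.
- rewrite (@divn_eq_range _ _ (2 * q + 2)); last by lia.
  by apply: (@three_factor_fill K charK0 _ (3 * q + 2) 0 (4 * q + 6) (2 * q) 0);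
    [lia | lia | lia | lia | exact: no_block_defect | lia].
- rewrite (@divn_eq_range _ _ (2 * q + 1)); last by lia.
  by apply: (@three_factor_fill K charK0 _ (3 * q + 1) 0 (4 * q + 4) (2 * q) 0);
    [lia | lia | lia | lia | exact: no_block_defect | lia].
- case: q n0 => [|p] n0.
    by apply: (@three_factor_fill K charK0 _ 0 0 2 0 0) => //; exact: no_block_defect.
  rewrite (@divn_eq_range _ _ (2 * p + 2)); last by lia.
  by apply: (@three_factor_fill K charK0 _ (3 * p + 3) 0 (4 * p + 6) (2 * p + 2) 0);
    [lia | lia | lia | lia | exact: no_block_defect | lia].
- rewrite (@divn_eq_range _ _ (2 * q + 1)); last by lia.
  apply: (@three_factor_fill K charK0 _ (3 * q) 1 (4 * q + 2) (2 * q + 1) (8 * q + 4));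
    [lia | lia | lia | lia | | lia].
  (* More than N tangent spaces are left for the line, and N of them fill it. *)
  apply: (@defect_mono K _ 2 1 (6 * q + 2).+1 0 0) => //; first by lia.
  by apply: matrix_defect => //; rewrite subnn.
- case: q n0 => [//|p] n0; rewrite (@divn_eq_range _ _ (2 * p + 2)); last by lia.
  apply: (@three_factor_fill K charK0 _ (3 * p + 2) 1 (4 * p + 5) (2 * p + 2) (5 * p + 6));
    [lia | lia | lia | lia | | lia].
  apply: matrix_defect => //; first by lia.
  have -> : (6 * p.+1).+1 - (5 * p + 6) = p + 1 by lia.
  by lia.
- rewrite (@divn_eq_range _ _ (2 * q + 1)); last by lia.
  apply: (@three_factor_fill K charK0 _ (3 * q) 3 (4 * q + 4) (2 * q + 1) (6 * q + 6));
    [lia | lia | lia | lia | | lia].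
  have -> : 6 * q + 6 = (6 * q + 4).+2 by lia.
  have -> : (3 * q).+1 * (4 * q + 4) = 3 * (2 * q + 1) * (2 * q + 1).-1 + (5 * (2 * q + 1) - 1) by lia.
  by apply: net_super_defect => //; lia.
Qed.
End Cases.

(** * Induction on the number of factors *)

Section Induction.
Variable K : fieldType.
Hypothesis charK0 : [pchar K]%R =i pred0.

Lemma defect_point_to_tangent n k c t r e : defect K n k c t r.+1 e -> defect K n k c t.+1 r e.
Proof.
move=> [p [q [G H]]].
exists (fun a => if a == t then q r else p a), q, G => phi h1 h2 h3; apply: H => // a.
  by move=> ha; have := h1 a (leqW ha); rewrite (ltn_eqF ha).
rewrite ltnS leq_eqVlt => /orP [/eqP ->|]; last exact: h2.
by have [] := h1 t (ltnSn t); rewrite eqxx.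
Qed.

Lemma tangent_defect_cut n k t e : defect K n k 1 t (n * t) e ->
  tangent_defect K n k.+1 (n.+1 * t) (n.+1 * e).
Proof.
move=> H; apply: tangent_defect_block.
have : defect K n k (n.+1 * 1) (n.+1 * t) 0 (n.+1 * e); last by rewrite muln1.
by apply: defect_pieces => //; rewrite mulSn addKn.
Qed.

Lemma tangent_defect_slices n k t e : tangent_defect K n k t e ->
  tangent_defect K n k.+1 (n.+1 * t) (n.+1 * (e - n * t)).
Proof.
move=> H; apply: tangent_defect_cut.
exact: (defect_add_points (n * t) (block_tangent_defect H)).
Qed.

(** The quotient t: the theorem concerns the multiples N t and N (t + 1). *)
Definition slice_count n k := n.+1 ^ k.-1 %/ (n * k + 1).

Lemma slice_le n k : slice_count n k * (n * k + 1) <= n.+1 ^ k.-1.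
Proof. exact: leq_trunc_div. Qed.

Lemma slice_gt n k : n.+1 ^ k.-1 < (slice_count n k).+1 * (n * k + 1).
Proof. by apply: ltn_ceil; rewrite addn1. Qed.

Definition sub_holds n k :=
  tangent_defect K n k (n.+1 * slice_count n k) (n.+1 ^ k - n.+1 * slice_count n k * (n * k + 1)).
Definition super_holds n k := tangent_defect K n k (n.+1 * (slice_count n k + 1)) 0.

Lemma sub_room n k : 0 < k -> n.+1 * slice_count n k * (n * k + 1) <= n.+1 ^ k.
Proof. by case: k => // k _; rewrite -mulnA expnS leq_mul2l slice_le orbT. Qed.

Lemma sub_fewer n k s : 0 < k -> sub_holds n k -> s <= n.+1 * slice_count n k ->
  tangent_defect K n k s (n.+1 ^ k - s * (n * k + 1)).
Proof. by move=> k0 H hs; apply: tangent_defect_fewer H; rewrite ?sub_room. Qed.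

(** Equality of dimensions: t (nk+1) for the tangent spaces and n t for the points make
    t (n(k+1)+1) in each slice. *)
Lemma sub_step n k : tangent_defect K n k (slice_count n k.+1) (n.+1 ^ k - slice_count n k.+1 * (n * k + 1)) ->
  sub_holds n k.+1.
Proof.
move=> /tangent_defect_slices; rewrite /sub_holds; apply: tangent_defect_mono => //.
by rewrite expnS -mulnA -mulnBr leq_mul2l; apply/orP; right; rewrite /=; nia.
Qed.

Lemma super_step n k :
  tangent_defect K n k (slice_count n k.+1).+1 (n.+1 ^ k - (slice_count n k.+1).+1 * (n * k + 1)) ->
  super_holds n k.+1.
Proof.
move=> /tangent_defect_slices; rewrite /super_holds (addn1 (slice_count _ _)); apply: tangent_defect_mono => //.
by rewrite leqn0 muln_eq0 /= subn_eq0; have := slice_gt n k.+1; rewrite /=; nia.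
Qed.

(** One tangent space fewer is known to be independent; the missing one still counts
    for one dimension, and the n (t+1) points do the rest if the division leaves at most N. *)
Lemma super_step_remainder n k :
  tangent_defect K n k (slice_count n k.+1) (n.+1 ^ k - slice_count n k.+1 * (n * k + 1)) ->
  n.+1 ^ k - slice_count n k.+1 * (n * k.+1 + 1) <= n.+1 ->
  super_holds n k.+1.
Proof.
move=> /block_tangent_defect /(defect_add_points (n * (slice_count n k.+1).+1).+1) H hr.
rewrite /super_holds (addn1 (slice_count _ _)); apply: (@tangent_defect_mono K n k.+1 (n.+1 * (slice_count n k.+1).+1) (n.+1 * 0)) => //; last first.
  apply: tangent_defect_cut; apply: defect_point_to_tangent.
  by apply: defect_mono H => //; move: hr; rewrite /=; nia.
by rewrite muln0.
Qed.

(** If k < t_k then n t_k exceeds the remainder of the division defining t_k, which is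
    what the rounding can cost. *)
Lemma slice_next n k : 0 < n -> 0 < k -> k < slice_count n k -> (slice_count n k.+1).+1 <= n.+1 * slice_count n k.
Proof.
case: k => // k n0 _ h; rewrite /slice_count ltn_divLR ?addn1 //=.
rewrite expnS -mulnA ltn_mul2l /=; have := slice_gt n k.+1; move: h; rewrite /slice_count /= !addn1; nia.
Qed.

Lemma power_growth n k0 k : 2 < k0 -> 0 < n -> k0.+1 * (n * k0 + 1) <= n.+1 ^ k0.-1 ->
  k0 <= k -> k.+1 * (n * k + 1) <= n.+1 ^ k.-1.
Proof.
move=> h0 n0 hb; elim: k => [|k IH]; first by lia.
rewrite leq_eqVlt => /orP [/eqP <- //|hk].
case: k IH hk => [|k] IH hk; first by lia.
have {}IH := IH hk; rewrite /= in IH *; rewrite expnS.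
apply: leq_trans (_ : 2 * (k.+2 * (n * k.+1 + 1)) <= _); last by apply: leq_mul.
have k2 : 2 < k.+1 by lia.
by nia.
Qed.

Lemma slice_large n k : 0 < n -> 3 < k ->
  [|| 3 < n, (1 < n) && (4 < k) | 6 < k] -> k < slice_count n k.
Proof.
move=> n0 k4 h; rewrite /slice_count leq_divRL; last by rewrite addn1.
have [h1|[h1|h1]] : (3 < n) \/ ((1 < n <= 3 /\ 4 < k) \/ (n = 1 /\ 6 < k)) by lia.
- by apply: (@power_growth n 4) => //=; rewrite !expnS expn0; nia.
- apply: (@power_growth n 5) => //=; last by lia.
  by have [->|->] : n = 2 \/ n = 3 by lia.
by have [-> k7] := h1; apply: (@power_growth 1 7).
Qed.

(** For N = 2 the two slices may receive different numbers of tangent spaces.  This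
    treats five and six factors, where t + 1 tangent spaces in one factor less are
    not covered by the induction hypothesis; three of them are dependent in four factors. *)
Lemma binary_tangent_split k t1 t2 e1 e2 :
  tangent_defect K 1 k t1 e1 -> tangent_defect K 1 k t2 e2 ->
  tangent_defect K 1 k.+1 (t1 + t2) ((e1 - t2) + (e2 - t1)).
Proof.
move=> /block_tangent_defect /(defect_add_points t2) H1.
move=> /block_tangent_defect /(defect_add_points t1) H2.
by apply: tangent_defect_block; apply: (@defect_split K charK0 1 k 1 1).
Qed.

Lemma binary_three : tangent_defect K 1 3 2 0.
Proof. exact: (three_factor_sub charK0 (n := 1)). Qed.

Lemma binary_four_two : tangent_defect K 1 4 2 6.
Proof.
have H : tangent_defect K 1 3 1 4 := tangent_defect_drop binary_three.
exact: (tangent_defect_slices H).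
Qed.

Lemma binary_four_three : tangent_defect K 1 4 3 2.
Proof.
have H : tangent_defect K 1 3 1 4 := tangent_defect_drop binary_three.
exact: (binary_tangent_split binary_three H).
Qed.

Lemma binary_five_six : tangent_defect K 1 5 6 0.
Proof. exact: (tangent_defect_slices binary_four_three). Qed.

Lemma binary_six_ten : tangent_defect K 1 6 10 0.
Proof. exact: (tangent_defect_slices (binary_tangent_split binary_four_three binary_four_two)). Qed.

Lemma slice_four n : 0 < n -> n != 2 -> (slice_count n 4).+1 <= sub3_bound n.+1.
Proof.
move=> n0 n2; rewrite /slice_count /= ltn_divLR ?addn1 //.
have hm : 0 < n.+1 by [].
have [m [e|[e|e]]] : exists m, n.+1 = m * 3 + 0 \/ (n.+1 = m * 3 + 1 \/ n.+1 = m * 3 + 2).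
  by exists (n.+1 %/ 3); lia.
- rewrite (sub3_boundE _ e) //; have -> : n = m * 3 - 1 by lia.
  have [p ->] : exists p, m = p + 2 by exists (m - 2); lia.
  have -> : (p + 2) * 3 - 1 = 3 * p + 5 by lia.
  by rewrite !expnS expn0; lia.
- rewrite (sub3_boundE _ e) //; have -> : n = m * 3 by lia.
  have [p ->] : exists p, m = p + 1 by exists (m - 1); lia.
  by rewrite !expnS expn0; nia.
rewrite (sub3_boundE _ e) //; have -> : n = m * 3 + 1 by lia.
by rewrite !expnS expn0; nia.
Qed.

Lemma sub3_room n : 0 < n -> sub3_bound n.+1 * (n * 3 + 1) <= n.+1 ^ 3.
Proof.
move=> n0.
have [m [e|[e|e]]] : exists m, n.+1 = m * 3 + 0 \/ (n.+1 = m * 3 + 1 \/ n.+1 = m * 3 + 2).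
  by exists (n.+1 %/ 3); lia.
- rewrite (sub3_boundE _ e) //; have [p em] : exists p, m = p + 1 by exists (m - 1); lia.
  have -> : n = 3 * p + 2 by lia.
  by rewrite em !expnS expn0; lia.
- rewrite (sub3_boundE _ e) //; have [p em] : exists p, m = p + 1 by exists (m - 1); lia.
  have -> : n = 3 * p + 3 by lia.
  by rewrite em !expnS expn0; lia.
rewrite (sub3_boundE _ e) //; have -> : n = 3 * m + 1 by lia.
by rewrite !expnS expn0; lia.
Qed.

Lemma three_factor_sub_fewer n s : 0 < n -> s <= sub3_bound n.+1 ->
  tangent_defect K n 3 s (n.+1 ^ 3 - s * (n * 3 + 1)).
Proof.
by move=> n0 hs; apply: tangent_defect_fewer hs (sub3_room n0) (three_factor_sub charK0 n0).
Qed.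

Lemma sub_super n k : 0 < n -> 2 < k -> sub_holds n k /\ super_holds n k.
Proof.
move=> n0; elim: k => // k IH; rewrite ltnS leq_eqVlt => /orP [/eqP <-|k3].
  split; last by apply: three_factor_super.
  have s3 : n.+1 * slice_count n 3 <= sub3_bound n.+1.
    rewrite /slice_count /=.
    have [m [e|[e|e]]] : exists m, n.+1 = m * 3 + 0 \/ (n.+1 = m * 3 + 1 \/ n.+1 = m * 3 + 2).
      by exists (n.+1 %/ 3); lia.
    - rewrite (sub3_boundE _ e) // (@divn_eq_range _ _ m); first by lia.
      have [p em] : exists p, m = p + 1 by exists (m - 1); lia.
      have -> : n = 3 * p + 2 by lia.
      by rewrite em !expnS expn0; lia.
    - rewrite (sub3_boundE _ e) // (@divn_eq_range _ _ m); first by lia.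
      have [p em] : exists p, m = p + 1 by exists (m - 1); lia.
      have -> : n = 3 * p + 3 by lia.
      by rewrite em !expnS expn0; lia.
    rewrite (sub3_boundE _ e) //; case: m e => [|p] e.
      by have -> : n = 1 by lia.
    rewrite (@divn_eq_range _ _ p.+1); first by lia.
    have -> : n = 3 * p + 4 by lia.
    by rewrite !expnS expn0; lia.
  exact: three_factor_sub_fewer.
have [sub super] := IH k3.
have k0 : 0 < k by lia.
case: (eqVneq k 3) => [->|k4].
  case: (eqVneq n 2) => [->|n2].
    split; first by apply: sub_step; apply: three_factor_sub_fewer.
    by apply: super_step_remainder => //; apply: three_factor_sub_fewer.
  have h := slice_four n0 n2; split.
    by apply: sub_step; apply: three_factor_sub_fewer => //; apply: ltnW.
  by apply: super_step; apply: three_factor_sub_fewer.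
have {k4}k4 : 3 < k by lia.
have go : (slice_count n k.+1).+1 <= n.+1 * slice_count n k -> sub_holds n k.+1 /\ super_holds n k.+1.
  move=> h; split; first by apply: sub_step; apply: sub_fewer => //; apply: ltnW.
  by apply: super_step; apply: sub_fewer.
have [h|h] := boolP [|| 3 < n, (1 < n) && (4 < k) | 6 < k].
  by apply: go; apply: slice_next => //; apply: slice_large.
have [[en ek]|[[en ek]|[[en ek]|[[en ek]|[en ek]]]]] : (n = 1 /\ k = 4) \/ ((n = 1 /\ k = 5) \/
   ((n = 1 /\ k = 6) \/ ((n = 2 /\ k = 4) \/ (n = 3 /\ k = 4)))) by lia.
- subst n k; split; last exact: binary_five_six.
  by apply: sub_step; apply: sub_fewer.
- subst n k; split; last exact: binary_six_ten.
  by apply: sub_step; apply: sub_fewer.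
- subst n k; split; first by apply: sub_step; apply: sub_fewer.
  by apply: super_step_remainder; first apply: sub_fewer.
- by subst n k; apply: go.
subst n k; split; first by apply: sub_step; apply: sub_fewer.
by apply: super_step_remainder; first apply: sub_fewer.
Qed.
End Induction.

(** * Differentials of the parametrization *)

Local Open Scope ring_scope.

Section PointCalculus.
Variable n : nat.

Lemma pt_rmorph (R S : comNzRingType) (f : {rmorphism R -> S}) k (x : nat -> nat -> R) (j : ix n k) :
  f (pt x j) = pt (fun i l => f (x i l)) j.
Proof. by elim: k j => [|k IH] j /=; rewrite ?rmorph1 // rmorphM IH. Qed.

Variable K : fieldType.
Implicit Types x y : nat -> nat -> K.

Lemma pt_scale k c x (j : ix n k) : pt (fun i l => c i * x i l) j = (\prod_(i < k) c i) * pt x j.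
Proof.
elim: k j => [|k IH] j /=; first by rewrite big_ord0 mul1r.
by rewrite IH big_ord_recr /= mulrACA.
Qed.

(** The differential of pt at x in the direction y. *)
Fixpoint dpt k x y : ix n k -> K :=
  match k return ix n k -> K with
  | 0 => fun _ => 0
  | k'.+1 => fun j => dpt x y j.1 * x k' j.2 + pt x j.1 * y k' j.2
  end.

Lemma pt_jet k x y (j : ix n k) : exists R : {poly K}, forall t,
  pt (fun i l => x i l + t * y i l) j = pt x j + t * dpt x y j + t ^+ 2 * R.[t].
Proof.
elim: k j => [|k IH] j /=.
  by exists 0 => t; rewrite horner0 !mulr0 !addr0.
have [R hR] := IH j.1.
exists ((dpt x y j.1 * y k j.2)%:P + R * ((x k j.2)%:P + 'X * (y k j.2)%:P)) => t.
by rewrite hR !(hornerD, hornerM, hornerC, hornerX); ring.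
Qed.

Lemma dpt_euler k x (j : ix n k) : dpt x x j = k%:R * pt x j.
Proof.
elim: k j => [|k IH] j /=; first by rewrite mul0r.
by rewrite IH -mulrA -[X in _ + X]mul1r -mulrDl natr1.
Qed.

Lemma dpt_sum k x q (w : 'I_q -> K) (y : 'I_q -> nat -> nat -> K) (j : ix n k) :
  dpt x (fun i l => \sum_b w b * y b i l) j = \sum_b w b * dpt x (y b) j.
Proof.
elim: k j => [|k IH] j /=; first by rewrite big1 // => b _; rewrite mulr0.
rewrite IH big_distrl big_distrr -big_split; apply: eq_bigr => b _ /=.
by rewrite mulrDr; congr (_ + _); [rewrite mulrA | rewrite mulrCA].
Qed.

Lemma eq_dpt k x y y' : (forall i l, (i < k)%N -> y i l = y' i l) -> dpt x y = dpt x y' :> (ix n k -> K).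
Proof.
elim: k => //= k IH h; apply: functional_extensionality => j.
by rewrite IH ?h // => i l hi; apply: h; apply: ltnW.
Qed.

Lemma dpt0 k x : dpt x (fun _ _ => 0) = (fun _ => 0) :> (ix n k -> K).
Proof.
elim: k => //= k IH; apply: functional_extensionality => j.
by rewrite IH mul0r mulr0 addr0.
Qed.

Lemma tangent_killP k x (phi : ix n k -> K) :
  (forall y, bra phi (dpt x y) = 0) -> tangent_kill x phi.
Proof.
elim: k phi => //= k IH phi h; split.
  move=> l; rewrite -(contract_delta phi l) -bra_block.
  rewrite -[RHS](h (fun i l' => if i == k then (l' == l)%:R else 0)); apply: eq_bigr => j _.
  rewrite eqxx (_ : dpt x _ j.1 = 0) ?mul0r ?add0r // -[RHS](congr1 (@^~ j.1) (dpt0 k x)).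
  by apply: (congr1 (@^~ j.1)); apply: eq_dpt => i l' hi; rewrite (ltn_eqF hi).
apply: IH => y; rewrite -bra_block -[RHS](h (fun i l' => if i == k then 0 else y i l')).
apply: eq_bigr => j _; rewrite eqxx mulr0 addr0; congr (_ * (_ * _)).
by apply: (congr1 (@^~ j.1)); apply: eq_dpt => i l' hi; rewrite (ltn_eqF hi).
Qed.
End PointCalculus.

Section Basis.
Variables (K : fieldType) (X : Type) (m e : nat).
Variables (T : (X -> K) -> 'I_m -> K) (G : nat -> 'I_m -> K) (u0 : X -> K) (j0 : 'I_m).
Hypothesis TG : forall phi : 'I_m -> K, (forall u, bra phi (T u) = 0) ->
  (forall i, (i < e)%N -> bra phi (G i) = 0) -> forall j, phi j = 0.
Hypothesis T0 : T u0 j0 != 0.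

(** As long as D + e < m, some nonzero phi kills the D vectors found so far and the e
    functionals, so it is not killed by all T u. *)
Lemma extend_independent D : (0 < D)%N -> (D + e <= m)%N ->
  exists2 u : nat -> X -> K, u 0%N = u0 &
  forall c : nat -> K, (forall j, \sum_(l < D) c l * T (u l) j = 0) ->
    forall l, (l < D)%N -> c l = 0.
Proof.
elim: D => // -[_ _ _|D IH _ hD].
  exists (fun _ => u0) => // c h [|//] _; have /eqP := h j0.
  by rewrite big_ord1 mulf_eq0 (negPf T0) orbF => /eqP.
have [//||u u00 ind] := IH; first by lia.
have card_lt : (#|{: 'I_D.+1 + 'I_e}| < m)%N by rewrite card_sum !card_ord.
have [phi [i0 nz] hphi] := @linear_dependence K m ('I_D.+1 + 'I_e)%type
  (fun j b => match b with inl l => T (u l) j | inr g => G g j end) card_lt.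
have [u' hu'] : exists u', bra phi (T u') != 0.
  apply: NNPP => none; case/eqP: nz; apply: TG => [v|i hi].
    by apply/eqP; apply: contraT => h; case: none; exists v.
  exact: (hphi (inr (Ordinal hi))).
exists (fun l => if l == D.+1 then u' else u l) => // c h.
have cu (l : 'I_D.+1) : (if (l : nat) == D.+1 then u' else u l) = u l by rewrite (ltn_eqF (ltn_ord l)).
have h' j : \sum_(l < D.+1) c l * T (u l) j + c D.+1 * T u' j = 0.
  by rewrite -[RHS](h j) [RHS]big_ord_recr /= eqxx; congr (_ + _); apply: eq_bigr => l _; rewrite cu.
have cD : c D.+1 = 0.
  have : \sum_j phi j * (\sum_(l < D.+1) c l * T (u l) j + c D.+1 * T u' j) = 0.
    by apply: big1 => j _; rewrite h' mulr0.
  under eq_bigr => j _ do rewrite mulrDr big_distrr /=.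
  rewrite big_split exchange_big /= big1 ?add0r => [|l _].
    under eq_bigr => j _ do rewrite mulrCA.
    by rewrite -big_distrr => /eqP; rewrite mulf_eq0 => /orP [/eqP //|/eqP z]; case/eqP: hu'.
  under eq_bigr => j _ do rewrite mulrCA.
  by rewrite -big_distrr (hphi (inl l)) /= mulr0.
move=> l; rewrite ltnS leq_eqVlt => /orP [/eqP -> //|]; apply: ind => j.
by rewrite -[RHS](h' j) cD mul0r addr0.
Qed.

Lemma dual_family D : (0 < D)%N -> (D + e <= m)%N ->
  exists2 u : nat -> X -> K, u 0%N = u0 & exists B : 'I_m -> nat -> K,
  forall l b, (l < D)%N -> (b < D)%N -> \sum_j T (u l) j * B j b = (l == b)%:R.
Proof.
move=> D0 hD; have [u u00 ind] := extend_independent D0 hD; exists u => //.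
pose A := \matrix_(l < D, j < m) T (u l) j.
have : row_free A.
  rewrite -kermx_eq0; apply/rowV0P => v /sub_kermxP vA; apply/rowP => l; rewrite mxE.
  pose c i := if insub i is Some i' then v 0 i' else 0.
  have cE (i : 'I_D) : c i = v 0 i by rewrite /c valK.
  rewrite -cE; apply: ind => // j.
  have /rowP /(_ j) := vA; rewrite !mxE => e0; rewrite -[RHS]e0.
  by apply: eq_bigr => i _; rewrite cE mxE.
case/row_freeP => B AB.
exists (fun j b => if insub b is Some b' then B j b' else 0) => l b hl hb.
have /matrixP /(_ (Ordinal hl) (Ordinal hb)) := AB; rewrite !mxE => e0; rewrite -[RHS]e0.
by apply: eq_bigr => j _; rewrite mxE /= insubT.
Qed.
End Basis.

(** * The parametrization of the secant variety *)

Section Index.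
Variables n k : nat.

Fixpoint enc k (g : nat -> 'I_n.+1) : ix n k :=
  match k return ix n k with 0 => tt | k'.+1 => (enc k' g, g k') end.

Lemma pt_enc (R : comNzRingType) (x : nat -> nat -> R) g :
  pt x (enc k g) = \prod_(i < k) x i (g i).
Proof. by elim: k => [|k' IH] /=; rewrite ?big_ord0 // big_ord_recr /= IH. Qed.

Lemma coord_enc g i : (i < k)%N -> ix_coord (enc k g) i = g i.
Proof.
elim: k => // k' IH; rewrite ltnS leq_eqVlt => /orP [/eqP ->|hi] /=; first by rewrite eqxx.
by rewrite (ltn_eqF hi) IH.
Qed.

Lemma coord_inj (j j' : ix n k) : (forall i, (i < k)%N -> ix_coord j i = ix_coord j' i) -> j = j'.
Proof.
elim: k j j' => [|k' IH] j j'; first by case: j; case: j'.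
case: j => j1 j2; case: j' => j1' j2' h; congr pair.
  by apply: IH => i hi; have := h i (ltnW hi); rewrite /= (ltn_eqF hi).
by apply: val_inj; have := h k' (ltnSn k'); rewrite /= eqxx.
Qed.

Lemma coord_lt (j : ix n k) i : (ix_coord j i < n.+1)%N.
Proof. by elim: k j => // k' IH j /=; case: ifP. Qed.

Definition ix_of (j : 'I_#|multi_index n k|) : ix n k :=
  enc k (fun i => if insub i is Some i' then (enum_val j : multi_index n k) i' else ord0).
Definition of_ix (j : ix n k) : 'I_#|multi_index n k| :=
  enum_rank ([ffun i : 'I_k => inord (ix_coord j i)] : multi_index n k).

Lemma of_ixK : cancel of_ix ix_of.
Proof.
move=> j; apply: coord_inj => i hi; rewrite coord_enc // insubT enum_rankK ffunE.
by rewrite inordK ?coord_lt.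
Qed.

Lemma ix_ofK : cancel ix_of of_ix.
Proof.
move=> j; apply: (canLR enum_valK); apply/ffunP => i; rewrite ffunE; apply: val_inj.
by rewrite coord_enc //= valK inord_val.
Qed.

Lemma sum_ix_of (V : nmodType) (f : ix n k -> V) : \sum_j f j = \sum_j f (ix_of j).
Proof. by apply: reindex; exists of_ix => j _; [exact: ix_ofK | exact: of_ixK]. Qed.

Lemma pt_ix_of (R : comNzRingType) (x : nat -> nat -> R) j :
  pt x (ix_of j) = \prod_(i < k) x i ((enum_val j : multi_index n k) i).
Proof. by rewrite pt_enc; apply: eq_bigr => i _; rewrite valK. Qed.

Lemma card_multi_index : #|multi_index n k| = (n.+1 ^ k)%N.
Proof. by rewrite card_ffun !card_ord. Qed.
End Index.

Section LinePolyEval.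
Variable K : fieldType.

Lemma line_poly_meval m (f : {mpoly K[m]}) (g : 'I_m -> config K -> K) :
  (forall j, line_poly (g j)) -> line_poly (fun z => f.@[fun j => g j z]).
Proof.
move=> hg z1 z2; have [q hq] := fin_all_exists (fun j => hg j z1 z2).
exists (\sum_(mu <- msupp f) f@_mu *: \prod_j q j ^+ mu j) => t.
rewrite mevalE horner_sum; apply: eq_bigr => mu _.
rewrite hornerZ horner_prod; congr (_ * _); apply: eq_bigr => j _.
by rewrite horner_exp hq.
Qed.

Lemma line_poly_bigprod (I : finType) (g : I -> config K -> K) :
  (forall i, line_poly (g i)) -> line_poly (fun z => \prod_i g i z).
Proof.
move=> hg z1 z2; have [q hq] := fin_all_exists (fun i => hg i z1 z2).
by exists (\prod_i q i) => t; rewrite horner_prod; apply: eq_bigr => i _; rewrite hq.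
Qed.
End LinePolyEval.

Section Secant.
Variable K : fieldType.
Hypothesis charK0 : [pchar K] =i pred0.
Variables (n k s : nat).
Hypothesis k0 : (0 < k)%N.
Local Notation M := #|multi_index n k|.
Local Notation params := (nat * nat * nat)%type.
Local Notation span := (span_union s (@segre K n k)).
Local Notation sigma := (secant_variety s (@segre K n k)).

Definition summand (R : Type) (p : params -> R) (a i l : nat) : R := p (a, i, l).

Definition sum_point (R : comNzRingType) (p : params -> R) (j : 'I_M) : R :=
  \sum_(a < s) pt (summand p a) (ix_of j).

Definition sum_diff (p u : params -> K) (j : 'I_M) : K :=
  \sum_(a < s) dpt (summand p a) (summand u a) (ix_of j).

Lemma sum_point_scale c p j :
  sum_point (fun x => c * p x : K) j = c ^+ k * sum_point p j.
Proof.
rewrite /sum_point big_distrr; apply: eq_bigr => a _ /=.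
by rewrite [LHS](pt_scale (fun _ => c)) prodr_const card_ord.
Qed.

Lemma sum_point_jet (p u : params -> K) : exists R : 'I_M -> {poly K}, forall t j,
  sum_point (fun x => p x + t * u x) j = sum_point p j + t * sum_diff p u j + t ^+ 2 * (R j).[t].
Proof.
have ex (ja : 'I_M * 'I_s) := pt_jet (summand p ja.2) (summand u ja.2) (ix_of ja.1).
have [R hR] := fin_all_exists ex.
exists (fun j => \sum_(a < s) R (j, a)) => t j.
rewrite /sum_point /sum_diff horner_sum !big_distrr -!big_split; apply: eq_bigr => a _ /=.
exact: (hR (j, a)).
Qed.

Lemma sum_diff_euler p j : sum_diff p p j = k%:R * sum_point p j.
Proof. by rewrite /sum_diff /sum_point big_distrr; apply: eq_bigr => a _; rewrite dpt_euler. Qed.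

Lemma sum_diff_sum p q (w : 'I_q -> K) (u : 'I_q -> params -> K) j :
  sum_diff p (fun x => \sum_b w b * u b x) j = \sum_b w b * sum_diff p (u b) j.
Proof.
rewrite /sum_diff; under [RHS]eq_bigr => b _ do rewrite big_distrr /=.
rewrite exchange_big; apply: eq_bigr => a _.
exact: (dpt_sum (summand p a) w (fun b => summand (u b) a)).
Qed.

Definition uncurry_config (z : config K) : params -> K := fun x => z x.1.1 x.1.2 x.2.

Lemma line_poly_sum_point j : line_poly (fun z => sum_point (uncurry_config z) j).
Proof. by apply: line_poly_sum => a; exact: line_poly_pt. Qed.

(** The point is generic also so that its image is nonzero: it starts the flag of cones
    in the dimension count. *)
Lemma generic_point e : (0 < s)%N -> tangent_defect K n k s e ->
  exists (p : params -> K) (G : nat -> 'I_M -> K) (j0 : 'I_M),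
    sum_point p j0 != 0 /\
    forall phi : 'I_M -> K, (forall u, bra phi (sum_diff p u) = 0) ->
      (forall i, (i < e)%N -> bra phi (G i) = 0) -> forall j, phi j = 0.
Proof.
move=> s0 [z1 [G H]].
pose j0 := of_ix (enc k (fun=> ord0) : ix n k).
pose P (z : config K) (phi : ix n k -> K) := forall a, (a < s)%N -> tangent_kill (z a) phi.
have o1 : line_open (fun z => separates (P z) e G).
  by apply: separates_open; apply: poly_linear_lt => a; exact: poly_linear_tangent_kill.
have o2 : line_open (fun z => sum_point (uncurry_config z) j0 != 0) := line_open_neq0 (line_poly_sum_point j0).
have [||z U V] := line_openI charK0 (z1 := z1) (z2 := fun a _ _ => (a == 0%N)%:R) o1 o2.
- exact: H.
- rewrite /sum_point (bigD1 (Ordinal s0)) //= big1 ?addr0 => [|a ne].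
    by rewrite of_ixK pt_enc big1 ?oner_neq0.
  rewrite of_ixK pt_enc (bigD1 (Ordinal k0)) //= /summand /uncurry_config /=.
  rewrite (_ : (a == 0%N :> nat) = false) ?mul0r //.
  by apply: contraNF ne => /eqP ea; apply/eqP/val_inj.
exists (uncurry_config z), (fun i j => G i (ix_of j)), j0; split => // phi h1 h2 j.
rewrite -[j]ix_ofK; apply: (U (fun j => phi (of_ix j))) => [a ha|i hi].
  apply: tangent_killP => y; rewrite /bra sum_ix_of.
  rewrite -[RHS](h1 (fun x => if x.1.1 == a then y x.1.2 x.2 else 0)); apply: eq_bigr => j' _.
  rewrite ix_ofK; congr (_ * _).
  rewrite /sum_diff (bigD1 (Ordinal ha)) //= big1 ?addr0 => [|a' ne].
    by apply: (congr1 (@^~ _)); apply: eq_dpt => i l _; rewrite /summand /= eqxx.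
  rewrite -[RHS](congr1 (@^~ (ix_of j')) (dpt0 n k (summand (uncurry_config z) a'))).
  apply: (congr1 (@^~ _)); apply: eq_dpt => i l _; rewrite /summand /=.
  by rewrite (_ : (a' == a :> nat) = false) //; apply: contraNF ne => /eqP ea; apply/eqP/val_inj.
rewrite -[RHS](h2 i hi) /bra sum_ix_of; apply: eq_bigr => j' _.
by rewrite ix_ofK.
Qed.

Lemma span_in_sigma v : span v -> sigma v.
Proof. by move=> hv; split=> [|d f _ hf]; [case: hv | exact: hf]. Qed.

(** A summand with a zero factor is zero; it is replaced by any decomposable tensor with
    coefficient 0. *)
Lemma sum_point_span p : (\row_j sum_point p j) != 0 -> span (\row_j sum_point p j).
Proof.
move=> nz; split => //.
pose x (a : 'I_s) (i : 'I_k) : 'rV[K]_n.+1 := \row_l p (a : nat, i : nat, l : nat).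
pose good a := [forall i, x a i != 0].
pose x' a i := if good a then x a i else const_mx 1.
have xnz a i : x' a i != 0.
  rewrite /x'; case: ifP => [/forallP //|_]; apply/eqP => /matrixP /(_ 0 0) /eqP.
  by rewrite !mxE oner_eq0.
exists (\matrix_(a < s) pure_tensor (x' a)); first by move=> a; rewrite rowK; exists (x' a).
apply/submxP; exists (\row_a (good a)%:R); apply/rowP => j; rewrite !mxE.
apply: eq_bigr => a _; rewrite !mxE pt_ix_of /x'.
case: (boolP (good a)) => [_|/forallPn [i /negPn /eqP xi0]].
  by rewrite mul1r; apply: eq_bigr => i _; rewrite !mxE.
rewrite mul0r (bigD1 i) //=; have /rowP /(_ ((enum_val j : multi_index n k) i)) := xi0.
by rewrite !mxE /summand => ->; rewrite mul0r.
Qed.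

Lemma sigma_vanish (p0 : params -> K) j0 : sum_point p0 j0 != 0 ->
  forall d (f : {mpoly K[M]}), f \is d.-homog -> vanishes_on f sigma ->
  forall p : params -> K, f.@[sum_point p] = 0.
Proof.
move=> nz d f hf fv p.
have E v : f.@[(\row_j v j : 'rV[K]_M) 0] = f.@[v].
  by apply: meval_eq => j; rewrite mxE.
case: (eqVneq (\row_j sum_point p j) 0) => [z|h]; last first.
  by rewrite -E; apply: fv; apply: span_in_sigma; exact: sum_point_span.
have w0 : f.@[sum_point p0] = 0.
  rewrite -E; apply: fv; apply: span_in_sigma; apply: sum_point_span.
  by apply: contraNneq nz => /rowP /(_ j0); rewrite !mxE => ->.
rewrite (meval_eq _ (v2 := fun j => 0 * sum_point p0 j)) => [|j].
  by rewrite (dhomog_meval _ _ hf) w0 mulr0.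
by have /rowP /(_ j) := z; rewrite !mxE mul0r.
Qed.

Definition sum_point_tuple (u : nat -> params -> K) q : M.-tuple {mpoly K[q]} :=
  [tuple sum_point (fun x => \sum_(l < q) (u l x)%:MP * 'X_l) j | j < M].

Lemma sum_point_tupleE u q (y : 'I_q -> K) j :
  (tnth (sum_point_tuple u q) j).@[y] = sum_point (fun x => \sum_(l < q) y l * u l x) j.
Proof.
rewrite tnth_mktuple /sum_point raddf_sum; apply: eq_bigr => a _ /=.
rewrite (pt_rmorph (meval y)); apply: (congr1 (@^~ _)); congr pt.
apply: functional_extensionality => i; apply: functional_extensionality => l.
rewrite /summand /= raddf_sum; apply: eq_bigr => b _ /=.
by rewrite mevalM mevalC mevalXU mulrC.
Qed.

(** By the Euler relation the differential at p maps p to k F(p), which is nonzero in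
    characteristic zero; so p can be the first vector of the flag. *)
Lemma secant_chain D e : (0 < s)%N -> (0 < D)%N -> (D + e <= M)%N -> tangent_defect K n k s e ->
  prime_chain sigma D.-1.
Proof.
move=> s0 D0 hD /(generic_point s0) [p [G [j0 [nz TG]]]].
have T0 : sum_diff p p j0 != 0.
  rewrite sum_diff_euler mulf_neq0 //.
  by rewrite (proj1 (pcharf0P K) charK0) -lt0n.
have [u u0 [B hB]] := dual_family TG T0 D0 hD.
apply: (@prime_chain_exists K charK0 params M k D (@sum_point K) sigma u
  (fun l => sum_diff p (u l)) (sum_point_tuple u) B) => //.
- by move=> p1 p2 /functional_extensionality ->.
- exact: sum_point_scale.
- exact: sum_point_tupleE.
- by move=> d f hf fv q; exact: sigma_vanish nz d f hf fv q.
- move=> q w; have [R hR] := sum_point_jet p (fun x => \sum_(l < q) w l * u l x).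
  by exists R => t j; rewrite u0 hR sum_diff_sum.
- by rewrite u0; exact: nz.
Qed.

Lemma secant_fills : (0 < s)%N -> tangent_defect K n k s 0 -> fills_ambient sigma.
Proof.
move=> s0 /(generic_point s0) [p [G [j0 [nz TG]]]].
have T0 : sum_diff p p j0 != 0.
  rewrite sum_diff_euler mulf_neq0 //.
  by rewrite (proj1 (pcharf0P K) charK0) -lt0n.
have M0 : (0 < M)%N by rewrite card_multi_index expn_gt0.
have M0' : (M + 0 <= M)%N by rewrite addn0.
have [u _ [B hB]] := dual_family TG T0 M0 M0'.
apply: (@jet_fills K charK0 M span (fun z => exists q, z = sum_point q) (sum_point p)).
  move=> d f hf fv _ [q ->]; apply: (sigma_vanish nz hf) => v hv.
  by case: hv => _ /(_ d f hf fv).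
pose A : 'M[K]_M := \matrix_(l, j) sum_diff p (u l) j.
pose B' : 'M[K]_M := \matrix_(j, b) B j b.
have AB : A *m B' = 1%:M.
  apply/matrixP => l b; rewrite !mxE -[RHS](hB l b) //.
  by apply: eq_bigr => j _; rewrite !mxE.
move=> v; pose c := (\row_j v j) *m B'.
have cA : c *m A = \row_j v j by rewrite -mulmxA (mulmx1C AB) mulmx1.
have [R hR] := sum_point_jet p (fun x => \sum_(l < M) c 0 l * u l x).
exists R => t; exists (fun x => p x + t * (\sum_(l < M) c 0 l * u l x)).
apply: functional_extensionality => j; rewrite hR sum_diff_sum.
congr (_ + _ * _ + _); have /rowP /(_ j) := cA; rewrite !mxE => <-.
by apply: eq_bigr => l _; rewrite !mxE.
Qed.

End Secant.

(** * An affine chart, and the theorem *)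

Section Chart.
Variable K : fieldType.
Hypothesis charK0 : [pchar K] =i pred0.
Variables (n k s : nat).
Local Notation M := #|multi_index n k|.
Local Notation span := (span_union s (@segre K n k)).
Local Notation sigma := (secant_variety s (@segre K n k)).
Local Notation b := (n * k + 1)%N.
Local Notation q := (s * b)%N.

(** The chart normalizes the first coordinate of each vector to 1; the variables of
    the a-th summand are numbered from a (nk+1), the first one being its coefficient. *)
Definition chart_vector (R : comNzRingType) (X : nat -> R) (a i l : nat) : R :=
  if l is l'.+1 then X (a * b + (i * n + l').+1)%N else 1.

Definition chart_point (R : comNzRingType) (X : nat -> R) (j : 'I_M) : R :=
  \sum_(a < s) X (a * b)%N * pt (chart_vector X a) (ix_of j).

Definition extend (R : comNzRingType) (y : 'I_q -> R) (r : nat) : R :=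
  if insub r is Some r' then y r' else 0.

Definition chart : M.-tuple {mpoly K[q]} :=
  [tuple chart_point (extend (fun r => 'X_r)) j | j < M].

Lemma chartE y j : (tnth chart j).@[y] = chart_point (extend y) j.
Proof.
have E r : (extend (fun r => 'X_r : {mpoly K[q]}) r).@[y] = extend y r.
  by rewrite /extend; case: insub => [r'|]; rewrite ?meval0 ?mevalXU.
rewrite tnth_mktuple /chart_point raddf_sum; apply: eq_bigr => a _ /=.
rewrite mevalM E (pt_rmorph (meval y)); congr (_ * _); apply: (congr1 (@^~ _)); congr pt.
apply: functional_extensionality => i; apply: functional_extensionality => -[|l] /=.
  exact: meval1.
exact: E.
Qed.

Lemma chart_onto (c : nat -> K) (x : config K) :
  (forall a i, (a < s)%N -> (i < k)%N -> x a i 0%N = 1) ->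
  exists y : 'I_q -> K, forall j,
    chart_point (extend y) j = \sum_(a < s) c a * pt (x a) (ix_of j).
Proof.
move=> x1.
pose g (r : nat) := if (r %% b)%N is r'.+1 then x (r %/ b)%N (r' %/ n)%N (r' %% n).+1 else c (r %/ b)%N.
exists (fun r => g r) => j.
have b0 : (0 < b)%N by rewrite addn1.
have E r : (r < q)%N -> extend (fun r : 'I_q => g r) r = g r.
  by move=> hr; rewrite /extend insubT.
apply: eq_bigr => a _; rewrite E; last by rewrite ltn_pmul2r // ltn_ord.
rewrite {1}/g modnMl mulnK //; congr (_ * _); rewrite !pt_ix_of; apply: eq_bigr => i _.
case: ((enum_val j : multi_index n k) i) => -[|l] /= hl; first by rewrite x1.
have hr : ((i * n + l).+1 < b)%N.
  have h : (i.+1 * n <= k * n)%N by rewrite leq_mul2r ltn_ord orbT.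
  by move: h; rewrite mulSn mulnC [(n * k)%N]mulnC; lia.
rewrite E; last first.
  have h : (a.+1 * b <= q)%N by rewrite leq_mul2r ltn_ord orbT.
  by apply: leq_trans h; rewrite mulSn addnC ltn_add2r.
rewrite /g modnMDl modn_small // divnMDl // divn_small // addn0.
by rewrite divnMDl ?modnMDl ?divn_small ?modn_small ?addn0 //; lia.
Qed.

(** Configurations with all first coordinates nonzero are dense and can be rescaled
    into the chart. *)
Lemma chart_dense (f : {mpoly K[M]}) : f \mPo chart = 0 ->
  forall (c : nat -> K) (z : config K),
    f.@[fun j => \sum_(a < s) c a * pt (z a) (ix_of j)] = 0.
Proof.
move=> f0 c z1; apply/eqP; apply: contraT => nz.
have o1 : line_open (fun z : config K => f.@[fun j => \sum_(a < s) c a * pt (z a) (ix_of j)] != 0).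
  apply: line_open_neq0; apply: line_poly_meval => j; apply: line_poly_sum => a.
  by apply: line_polyM; [exact: line_polyC | exact: line_poly_pt].
have o2 : line_open (fun z : config K => \prod_(a < s) \prod_(i < k) z a i 0%N != 0).
  apply: line_open_neq0; do 2!apply: line_poly_bigprod => ?.
  exact: line_poly_coord.
have [||z U V] := line_openI charK0 (z1 := z1) (z2 := fun _ _ _ => 1) o1 o2; first exact: nz.
  by rewrite big1 ?oner_neq0 // => a _; rewrite big1.
have V' a i : (a < s)%N -> (i < k)%N -> z a i 0%N != 0.
  move=> ha hi; have /prodf_neq0 /(_ (Ordinal ha) isT) := V.
  by move/prodf_neq0 => /(_ (Ordinal hi) isT).
have [|y hy] := @chart_onto (fun a => c a * \prod_(i < k) z a i 0%N) (fun a i l => (z a i 0%N)^-1 * z a i l).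
  by move=> a i ha hi; rewrite mulVf // V'.
case/eqP: U; have := congr1 (meval y) f0; rewrite meval0 comp_mpoly_meval => e0.
rewrite -[RHS]e0; apply: meval_eq => j; rewrite chartE hy; apply: eq_bigr => a _.
rewrite (pt_scale (fun i => (z a i 0%N)^-1)) mulrA -mulrA -mulrA; congr (_ * _).
rewrite mulrA -big_split /= big1 ?mul1r // => i _.
by rewrite mulfV // V'.
Qed.

Lemma chart_span (f : {mpoly K[M]}) : f \mPo chart = 0 -> vanishes_on f span.
Proof.
move=> f0 v [_ [A hA /submxP [D ->]]].
have [x hx] := fin_all_exists (fun a => let: ex_intro2 x _ e := hA a in ex_intro _ x e).
pose z a i l := if insub a is Some a' then if insub i is Some i' then x a' i' 0 (inord l) else 0 else 0.
pose c a := if insub a is Some a' then D 0 a' else 0.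
rewrite -[RHS](chart_dense f0 c z); apply: meval_eq => j; rewrite mxE.
apply: eq_bigr => a _; rewrite /c valK; congr (_ * _).
have /rowP /(_ j) := hx a; rewrite !mxE => ->; rewrite pt_ix_of.
by apply: eq_bigr => i _; rewrite /z !valK inord_val.
Qed.

Lemma secant_chain_bound e : prime_chain sigma e -> (e < q)%N.
Proof.
apply: (@prime_chain_bound K M q chart) => f f0 d v [_ hv].
apply: (hv d); first exact: pihomogP.
move=> w [w0 [A hA wA]]; apply: (@pihomog_vanish K charK0 M 1) => // t t0.
have tw : span (t *: w).
  by split; [rewrite scalemx_eq0 negb_or t0 | exists A => //; apply: scalemx_sub].
rewrite -[RHS](chart_span f0 tw); apply: meval_eq => j.
by rewrite mxE expr1.
Qed.
End Chart.

Local Close Scope ring_scope.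

Theorem theorem5p2 (K : fieldType) (charK0 : [pchar K]%R =i pred0)
    (n k : nat) (hn : 1 <= n) (hk : 3 <= k)
    (s_k delta_k : nat)
    (def_s_k : s_k = n.+1 ^ k %/ (n * k + 1))
    (delta_k_le : delta_k <= n)
    (delta_k_mod : delta_k = s_k %[mod n.+1]) :
  forall s : nat, 0 < s ->
    (s <= s_k - delta_k ->
       has_dimension (secant_variety s (@segre K n k)) (expected_dim n k s)) /\
    (s_k - delta_k + n + 1 <= s ->
       fills_ambient (secant_variety s (@segre K n k))).
Proof.
move=> s s0.
have k0 : 0 < k by apply: leq_trans hk.
have [sub super] := sub_super charK0 hn hk.
have bound : s_k - delta_k = n.+1 * slice_count n k.
  have -> : delta_k = s_k %% n.+1 by rewrite -delta_k_mod modn_small.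
  have -> : slice_count n k = s_k %/ n.+1.
    by rewrite def_s_k divnAC /slice_count; case: (k) k0 => // k' _; rewrite expnS mulKn.
  by rewrite [X in X - _](divn_eq s_k n.+1) addnK mulnC.
rewrite bound; split=> hs; last first.
  apply: secant_fills => //; apply: tangent_defect_mono super => //.
  by move: hs; rewrite mulnDr muln1; lia.
have room : s * (n * k + 1) <= n.+1 ^ k.
  by apply: leq_trans (sub_room n k0); rewrite leq_mul2r hs orbT.
have D0 : 0 < s * (n * k + 1) by rewrite muln_gt0 s0 addn1.
have -> : expected_dim n k s = (s * (n * k + 1)).-1.
  by rewrite /expected_dim -mulnA -[X in _ + X](muln1 s) -mulnDr; lia.
split.
  apply: (secant_chain charK0 k0 s0 D0 _ (sub_fewer k0 sub hs)).
  by rewrite subnKC // card_multi_index.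
by move=> e /(secant_chain_bound charK0); lia.
Qed.
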